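(* Let $E$ be a real Banach lattice with order continuous norm. Let $T:E\to E$ be a positive, power bounded and irreducible Harris operator with $\mathrm{Fix}(T)\neq\{0\}$. Then there exists $n\in\mathbb{N}$ such that $T^{nk}$ converges strongly as $k\to\infty$. If, moreover, $T$ is strongly positive, i.e. $Tx$ is a quasi-interior point of $E_+$ for all $x>0$, then there exist a strictly positive $x' \in \mathrm{Fix}(T')$ and a quasi-interior point $e$ of $E_+$ with $e \in \mathrm{Fix}(T)$ such that $\lim_{k\to\infty} T^k x = \langle x',x\rangle\, e$ for all $x\in E$.
   Context: Let $E$ be a real Banach lattice with order continuous norm, $E_+$ its positive cone, and $\mathbb{N}=\{1,2,\dots\}$; $x>0$ means $x\in E_+$ and $x\ne0$. An element $y\in E_+$ is a quasi-interior point of $E_+$ if the principal ideal $E_y=\{x\in E: |x|\le cy \text{ for some } c>0\}$ is dense in $E$. A positive functional $x'\in E'$ is strictly positive if $\langle x',|x|\rangle>0$ for all $x\ne0$. $\mathrm{Fix}(T)=\ker(I-T)$, and $T'$ is the adjoint of $T$. An operator $T$ on $E$ is power bounded if $\sup_{n\ge 0}\|T^n\|<\infty$. It is irreducible if the only closed (lattice) ideals $J\subseteq E$ with $TJ\subseteq J$ are $\{0\}$ and $E$. A linear operator on $E$ is regular if it is the difference of two positive operators; the regular operators on $E$ form an order complete vector lattice. $E'\otimes E$ denotes the space of finite rank operators on $E$, and $(E'\otimes E)^{\perp}$ its disjoint complement in the lattice of regular operators. A regular operator $T$ is a Harris operator if $T^n\notin (E'\otimes E)^{\perp}$ for some $n\in\mathbb{N}$.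 *)

(* Defs.v *)
From HB Require Import structures.
From mathcomp Require Import all_boot all_order all_algebra.
From mathcomp Require Import all_classical all_reals all_analysis.
Import Order.TTheory GRing.Theory Num.Theory.
Import numFieldNormedType.Exports.

Set Implicit Arguments.
Unset Strict Implicit.
Unset Printing Implicit Defensive.

Local Open Scope classical_set_scope.
Local Open Scope ring_scope.

(* The order is not inherited from the [Order] hierarchy: Hierarchy-Builder
   rejects a join of [Order.Lattice] with normed modules defined after
   [Num.RealDomain].  The MathComp lattice is recovered on an alias below. *)
HB.mixin Record isBanachLattice (R : realType) E of CompleteNormedModule R E := {
  vle : rel E ;
  vmeet : E -> E -> E ;
  vjoin : E -> E -> E ;
  vle_refl : reflexive vle ;
  vle_anti : antisymmetric vle ;
  vle_trans : transitive vle ;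
  vle_meet : forall x y z : E, vle x (vmeet y z) = vle x y && vle x z ;
  vjoin_le : forall x y z : E, vle (vjoin x y) z = vle x z && vle y z ;
  vle_add2r : forall x y z : E, vle x y -> vle (x + z) (y + z) ;
  vscale_ge0 : forall (a : R) (x : E), 0 <= a -> vle 0 x -> vle 0 (a *: x) ;
  vnorm_le : forall x y : E,
    vle (vjoin x (- x)) (vjoin y (- y)) -> `|x| <= `|y| }.

#[short(type="banachLatticeType")]
HB.structure Definition BanachLattice (R : realType) :=
  { E of isBanachLattice R E & CompleteNormedModule R E }.

Notation "x <=v y" := (vle x y) (at level 70, y at next level) : ring_scope.
Notation "x <v y" := ((vle x y) && (y != x))
  (at level 70, y at next level) : ring_scope.

Definition order_of (R : realType) (E : banachLatticeType R) : Type := E.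

HB.instance Definition _ (R : realType) (E : banachLatticeType R) :=
  Choice.on (order_of E).
HB.instance Definition _ (R : realType) (E : banachLatticeType R) :=
  Order.Le_isPOrder.Build Order.default_display (order_of E)
    (@vle_refl R E) (@vle_anti R E) (@vle_trans R E).
HB.instance Definition _ (R : realType) (E : banachLatticeType R) :=
  Order.POrder_MeetJoin_isLattice.Build Order.default_display (order_of E)
    (@vle_meet R E) (@vjoin_le R E).

(* [`|x|] is the norm of x, a scalar; the lattice modulus is an element of E. *)
Definition modulus (R : realType) (E : banachLatticeType R) (x : E) : E :=
  vjoin x (- x).

Definition directed_to0 (R : realType) (E : banachLatticeType R) (A : set E) :=
  [/\ A !=set0,
      forall x y, A x -> A y -> exists z, [/\ A z, z <=v x & z <=v y],
      forall x, A x -> 0 <=v x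
    & forall l : E, (forall x, A x -> l <=v x) -> l <=v 0].

(* A downward directed set is regarded as a decreasing net indexed by itself. *)
Definition order_continuous_norm (R : realType) (E : banachLatticeType R) :=
  forall A : set E, directed_to0 A ->
  forall eps : R, 0 < eps ->
  exists x : E, A x /\ forall y : E, A y -> y <=v x -> `|y| < eps.

Section Ideals.
Variables (R : realType) (E : banachLatticeType R).

Definition lattice_ideal (J : set E) :=
  [/\ J 0,
      forall x y, J x -> J y -> J (x + y),
      forall (a : R) x, J x -> J (a *: x)
    & forall x y, J y -> modulus x <=v modulus y -> J x].

Definition principal_ideal (y : E) : set E :=
  [set x | exists c : R, 0 < c /\ modulus x <=v c *: y].

Definition quasi_interior (y : E) := 0 <=v y /\ dense (principal_ideal y).

End Ideals.

Section Operators.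
Variables (R : realType) (E : banachLatticeType R).
Implicit Types S T M : E -> E.

Definition positive_op T := forall x : E, 0 <=v x -> 0 <=v T x.

Definition strongly_positive T := forall x : E, 0 <v x -> quasi_interior (T x).

Definition op_norm T : \bar R :=
  ereal_sup [set (`|T x|)%:E | x in [set x : E | `|x| <= 1]].

Definition power_bounded T :=
  (ereal_sup [set op_norm (iter n T) | n in [set: nat]] < +oo)%E.

Definition irreducible_op T :=
  forall J : set E, lattice_ideal J -> closed J -> T @` J `<=` J ->
  J = [set 0] \/ J = [set: E].

Definition regular : set (E -> E) :=
  [set T | exists A B : {linear E -> E},
    [/\ positive_op A, positive_op B & forall x, T x = A x - B x]].

Definition op_le S T := forall x : E, 0 <=v x -> S x <=v T x.

Definition op_lub (A : set (E -> E)) M :=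
  [/\ regular M,
      forall S, A S -> op_le S M
    & forall N, regular N -> (forall S, A S -> op_le S N) -> op_le M N].

Definition op_glb (A : set (E -> E)) M :=
  [/\ regular M,
      forall S, A S -> op_le M S
    & forall N, regular N -> (forall S, A S -> op_le N S) -> op_le N M].

(* Lattice operations on regular operators are given as relations: the suprema
   and infima below exist (uniquely) as soon as E is order complete, which
   follows from order continuity of the norm, but not in every Banach lattice. *)
Definition op_modulus T M := op_lub [set T; (fun x => - T x)] M.

Definition op_disjoint S T :=
  exists M N, [/\ op_modulus S M, op_modulus T N
                & op_glb [set M; N] (fun=> 0)].

Definition disjoint_complement (A : set (E -> E)) : set (E -> E) :=
  [set T | regular T /\ forall S, A S -> op_disjoint S T].

(* E' is the set of continuous elements of [{scalar E}]. *)
Definition finite_rank : set (E -> E) :=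
  [set T | exists (m : nat) (f : 'I_m -> {scalar E}) (y : 'I_m -> E),
    (forall i, continuous (f i : E -> R)) /\
    forall x, T x = \sum_(i < m) f i x *: y i].

Definition harris T :=
  regular T /\
  exists n : nat, (0 < n)%N /\ ~ disjoint_complement finite_rank (iter n T).

Definition adjoint T (f : E -> R) : E -> R := f \o T.

Definition strictly_positive (f : E -> R) :=
  (forall x : E, 0 <=v x -> 0 <= f x) /\
  (forall x : E, x != 0 -> 0 < f (modulus x)).

End Operators.

(* The kernel of I - T, used both for T on E and for the adjoint on functionals. *)
Definition Fix (V : zmodType) (T : V -> V) : set V := [set x | x - T x = 0].

Definition strongly_converges (R : realType) (E : banachLatticeType R)
    (U : nat -> E -> E) :=
  exists S : {linear E -> E}, continuous S /\
  forall x : E, U k x @[k --> \oo] --> S x.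

(* Main.v *)
Require Import Defs.
From HB Require Import structures.
From mathcomp Require Import all_boot all_order all_algebra.
From mathcomp Require Import all_classical all_reals all_analysis.
From mathcomp Require Import ring lra zify.
Import Order.TTheory GRing.Theory Num.Theory.
Import numFieldNormedType.Exports.
Local Open Scope classical_set_scope.
Local Open Scope ring_scope.

Set Implicit Arguments.
Unset Strict Implicit.
Unset Printing Implicit Defensive.

(** Everything rests on a strictly positive functional [phi] invariant under [T]
    and a fixed vector [e > 0]. For a fixed vector [x] of [T] one has
    [|x| <= T |x|], so the Cesaro means of [|x|] do not tend to 0 and the
    Hahn-Banach theorem yields a positive invariant functional that is nonzero at
    [|x|] ([invariant_functional]). Its null ideal is closed and invariant, hence
    trivial by irreducibility, and then [phi] turns every inequality [y <= T y]
    into an equality; in particular [e = |x|] is fixed and quasi-interior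
    ([fixed_point_setup]). Because the norm is order continuous, smallness of
    [phi] on an order interval forces smallness in norm ([small_on_interval]), so
    that on the dense ideal generated by [e] all estimates can be made with the
    additive quantity [phi |x|], as in an L1 space.

    The Harris property provides a positive operator [K <> 0] with [K <= T^n] and
    [K x <= g(x) y] for some positive functional [g] and some [y >= 0]
    ([harris_minorant]). The operators [K T^i K] all lie below one multiple of
    this operator of rank one. If they were pairwise disjoint, then their sums
    would lie below it too, and [K u_N] would stay bounded for
    [u_N = sum_(i < N) T^i K e]; but [t u_N] truncated by [e] tends to [e] for every
    [t > 0] ([recurrence]), so [K e] would vanish. Hence some [L <> 0] lies below
    both [T^m] and [T^(d+m)] with [d >= 1] ([overlapping_powers]).

    This overlap gives a zero-two law. Write [V = T^d], [B = (I + V) / 2],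
    [U = T^(d+m)]; then [U = B L + Q] with [Q >= 0]. On the ideal of a suitable
    nonzero fixed vector of [U] the powers of [Q] tend to 0
    ([residual_vanishes]), so that orbits are approximated by vectors [B w] with
    [phi w] controlled, and by iteration, since [B] commutes with [T], by
    [B^l w] for every [l]. The coefficients of [(I - V) B^l] have total variation
    about [l^(-1/2)] ([average_variation]); thus [T^k (I - T^d) x] tends to 0 for
    every [x] ([zero_two]).

    Finally the Cesaro means of [S = T^d] converge: the limit superior of the means
    is a fixed vector, and a maximal inequality bounds its [phi]-value
    ([maximal_ergodic]), which applied to [x] and to [b - x] identifies upper and
    lower limits ([mean_ergodic]). Together with [S^k (I - S) x -> 0] this shows
    that [S^k] converges strongly ([powers_converge]). If [T] is strongly positive,
    the positive and negative parts of a fixed vector of [S] cannot both be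
    nonzero ([fixed_iter_sign]), so the limit of [S^k x] is the multiple of [e]
    with the same [phi]-value, and it is then the limit of the whole orbit. *)

(** * Linear identities in a module *)

Section LinearIdentities.
Variables (R : pzRingType) (V : lmodType R).

Inductive lin_expr : Type :=
  | LVar of nat
  | LZero
  | LAdd of lin_expr & lin_expr
  | LOpp of lin_expr
  | LScale of R & lin_expr
  | LMuln of lin_expr & nat.

Fixpoint lin_eval (env : seq V) (t : lin_expr) : V :=
  match t with
  | LVar i => nth 0 env i
  | LZero => 0
  | LAdd a b => lin_eval env a + lin_eval env b
  | LOpp a => - lin_eval env a
  | LScale c a => c *: lin_eval env a
  | LMuln a n => lin_eval env a *+ n
  end.

Fixpoint lin_coef (t : lin_expr) (i : nat) : R :=
  match t with
  | LVar j => if Nat.eqb j i then 1 else 0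
  | LZero => 0
  | LAdd a b => lin_coef a i + lin_coef b i
  | LOpp a => - lin_coef a i
  | LScale c a => c * lin_coef a i
  | LMuln a n => lin_coef a i *+ n
  end.

Lemma lin_eval_coef env t :
  lin_eval env t = \sum_(i < size env) lin_coef t i *: nth 0 env i.
Proof.
elim: t => /= [j||a -> b ->|a ->|c a ->|a -> n].
- have E i : Nat.eqb j i = (j == i).
    by elim: j i => [|j IH] [|i] //=; rewrite IH.
  have [lt|ge] := ltnP j (size env); last first.
    rewrite nth_default// big1 // => i _; rewrite E.
    case: eqP => [ji|]; last by rewrite scale0r.
    by move: (ltn_ord i); rewrite -ji ltnNge ge.
  rewrite (bigD1 (Ordinal lt)) //= E eqxx scale1r big1 ?addr0 // => i ij.
  rewrite E; case: eqP => [ji|]; last by rewrite scale0r.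
  by move: ij; rewrite -val_eqE /= ji eqxx.
- by rewrite big1 // => i _; rewrite scale0r.
- by rewrite -big_split /=; apply: eq_bigr => i _; rewrite scalerDl.
- by rewrite -sumrN; apply: eq_bigr => i _; rewrite scaleNr.
- by rewrite scaler_sumr; apply: eq_bigr => i _; rewrite scalerA.
- by rewrite -sumrMnl; apply: eq_bigr => i _; rewrite scalerMnl.
Qed.

Fixpoint all_below (n : nat) (P : nat -> Prop) : Prop :=
  if n is m.+1 then P m /\ all_below m P else True.

Lemma all_belowP n P : all_below n P -> forall i, (i < n)%N -> P i.
Proof.
elim: n => //= n IH [Pn Pb] i; rewrite ltnS leq_eqVlt => /orP[/eqP->//|].
exact: IH.
Qed.

Lemma lin_eq env a b :
  all_below (size env) (fun i => lin_coef a i = lin_coef b i) ->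
  lin_eval env a = lin_eval env b.
Proof.
move=> /all_belowP ab; rewrite !lin_eval_coef.
by apply: eq_bigr => i _; rewrite ab.
Qed.

End LinearIdentities.

(* Atoms are compared up to conversion: the same vector may carry different
   paths through the hierarchy of structures. *)
Ltac lin_mem x l :=
  lazymatch l with
  | nil => constr:(false)
  | ?y :: ?l' =>
      match goal with
      | _ => let _ := match goal with _ => unify x y end in constr:(true)
      | _ => lin_mem x l'
      end
  end.

Ltac lin_atoms t l :=
  lazymatch t with
  | @GRing.add _ ?a ?b => let l1 := lin_atoms a l in lin_atoms b l1
  | @GRing.opp _ ?a => lin_atoms a l
  | @GRing.scale _ _ _ ?a => lin_atoms a l
  | @GRing.natmul _ ?a _ => lin_atoms a l
  | @GRing.zero _ => l
  | _ => lazymatch lin_mem t l with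
         | true => l
         | false => constr:(t :: l)
         end
  end.

Ltac lin_index x l :=
  lazymatch l with
  | ?y :: ?l' =>
      match goal with
      | _ => let _ := match goal with _ => unify x y end in constr:(0%N)
      | _ => let i := lin_index x l' in constr:(S i)
      end
  end.

Ltac lin_reify R t l :=
  lazymatch t with
  | @GRing.add _ ?a ?b =>
      let a' := lin_reify R a l in let b' := lin_reify R b l in
      constr:(LAdd a' b')
  | @GRing.opp _ ?a => let a' := lin_reify R a l in constr:(LOpp a')
  | @GRing.scale _ _ ?c ?a =>
      let a' := lin_reify R a l in constr:(@LScale R c a')
  | @GRing.natmul _ ?a ?n => let a' := lin_reify R a l in constr:(LMuln a' n)
  | @GRing.zero _ => constr:(@LZero R)
  | _ => let i := lin_index t l in constr:(@LVar R i)
  end.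

(* Reduces an equation in a module to the equality of the scalar coefficients
   of every atom. *)
Ltac lin_module R V :=
  lazymatch goal with
  | |- @eq ?T ?a ?b =>
      let l0 := lin_atoms a (@nil T) in
      let l := lin_atoms b l0 in
      let a' := lin_reify R a l in
      let b' := lin_reify R b l in
      refine (@lin_eq R V l a' b' _);
      cbn [all_below size lin_coef Nat.eqb]; repeat split
  end.

(** * Vector lattices *)

Section VectorLattice.
Variables (R : realType) (E : banachLatticeType R).
Implicit Types x y z u v w : E.

(** Two inequalities with the same difference are equivalent: this turns every
    linear rearrangement of an inequality into a linear identity. *)
Lemma vle_lin x y a b : x <=v y -> b - a = y - x -> a <=v b.
Proof.
move=> xy e; have := vle_add2r _ _ (a - x) xy.
have -> : x + (a - x) = a by lin_module R E; ring.
by have -> : y + (a - x) = b by rewrite -[b](subrK a) e; lin_module R E; ring.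
Qed.

Lemma vle_tr y x z : x <=v y -> y <=v z -> x <=v z.
Proof. exact: vle_trans. Qed.

Lemma vle_eq x y : x <=v y -> y <=v x -> x = y.
Proof. by move=> xy yx; apply: vle_anti; rewrite xy. Qed.

Lemma vleD x y u v : x <=v y -> u <=v v -> x + u <=v y + v.
Proof.
move=> xy uv; apply: (@vle_tr (y + u)); first exact: vle_add2r.
by apply: vle_lin uv _; lin_module R E; ring.
Qed.

Lemma vle_sub0 x y : x <=v y -> 0 <=v y - x.
Proof. by move=> xy; apply: vle_lin xy _; lin_module R E; ring. Qed.

Lemma vle_subr x y : 0 <=v y -> x - y <=v x.
Proof. by move=> xy; apply: vle_lin xy _; lin_module R E; ring. Qed.

Lemma vle_addr x y : 0 <=v y -> x <=v x + y.
Proof. by move=> xy; apply: vle_lin xy _; lin_module R E; ring. Qed.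

Lemma vleN x y : x <=v y -> - y <=v - x.
Proof. by move=> xy; apply: vle_lin xy _; lin_module R E; ring. Qed.

Lemma vadd_ge0 x y : 0 <=v x -> 0 <=v y -> 0 <=v x + y.
Proof. by move=> x0 y0; have := vleD x0 y0; rewrite addr0. Qed.

Lemma vleZ (a : R) x y : 0 <= a -> x <=v y -> a *: x <=v a *: y.
Proof.
move=> a0 /vle_sub0 /(vscale_ge0 _ _ a0) h.
by apply: vle_lin h _; lin_module R E; ring.
Qed.

Lemma vleZl (a b : R) x : a <= b -> 0 <=v x -> a *: x <=v b *: x.
Proof.
rewrite -subr_ge0 => ab /(vscale_ge0 _ _ ab) h.
by apply: vle_lin h _; lin_module R E; ring.
Qed.

Lemma vsum_ge0 (I : Type) (r : seq I) (P : pred I) (F : I -> E) :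
  (forall i, P i -> 0 <=v F i) -> 0 <=v \sum_(i <- r | P i) F i.
Proof.
by move=> h; elim/big_ind: _ => //; [exact: vle_refl|exact: vadd_ge0].
Qed.

Lemma vle_sum (I : Type) (r : seq I) (P : pred I) (F G : I -> E) :
  (forall i, P i -> F i <=v G i) ->
  \sum_(i <- r | P i) F i <=v \sum_(i <- r | P i) G i.
Proof.
move=> h; elim/big_ind2: _ => //; [exact: vle_refl|].
by move=> x1 x2 y1 y2; exact: vleD.
Qed.

Lemma vle_joinl x y : x <=v vjoin x y.
Proof. by have := vjoin_le x y (vjoin x y); rewrite vle_refl => /esym/andP[]. Qed.

Lemma vle_joinr x y : y <=v vjoin x y.
Proof. by have := vjoin_le x y (vjoin x y); rewrite vle_refl => /esym/andP[]. Qed.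

Lemma vjoin_lub x y z : x <=v z -> y <=v z -> vjoin x y <=v z.
Proof. by rewrite vjoin_le => -> ->. Qed.

Lemma vmeet_lel x y : vmeet x y <=v x.
Proof. by have := vle_meet (vmeet x y) x y; rewrite vle_refl => /esym/andP[]. Qed.

Lemma vmeet_ler x y : vmeet x y <=v y.
Proof. by have := vle_meet (vmeet x y) x y; rewrite vle_refl => /esym/andP[]. Qed.

Lemma vmeet_glb x y z : z <=v x -> z <=v y -> z <=v vmeet x y.
Proof. by rewrite vle_meet => -> ->. Qed.

Definition vpos x : E := vjoin x 0.

Lemma vpos_ge0 x : 0 <=v vpos x. Proof. exact: vle_joinr. Qed.
Lemma vle_vpos x : x <=v vpos x. Proof. exact: vle_joinl. Qed.
Lemma vpos_lub x z : x <=v z -> 0 <=v z -> vpos x <=v z.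
Proof. exact: vjoin_lub. Qed.

Lemma vpos_id x : 0 <=v x -> vpos x = x.
Proof.
move=> x0; apply: vle_eq (vle_vpos _); apply: vpos_lub => //; exact: vle_refl.
Qed.

Lemma vpos0 : vpos 0 = 0. Proof. exact/vpos_id/vle_refl. Qed.

Lemma vpos_mono x y : x <=v y -> vpos x <=v vpos y.
Proof.
by move=> xy; apply: vpos_lub; [exact: vle_tr xy (vle_vpos _)|exact: vpos_ge0].
Qed.

Lemma vposD x y : vpos (x + y) <=v vpos x + vpos y.
Proof.
by apply: vpos_lub; [exact: vleD (vle_vpos _) (vle_vpos _)|
  exact: vadd_ge0 (vpos_ge0 _) (vpos_ge0 _)].
Qed.

Lemma vposN x : vpos (- x) = vpos x - x.
Proof.
apply: vle_eq.
  apply: vpos_lub; last exact/vle_sub0/vle_vpos.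
  by apply: vle_lin (vpos_ge0 x) _; lin_module R E; ring.
suff h : vpos x <=v vpos (- x) + x by apply: vle_lin h _; lin_module R E; ring.
apply: vpos_lub.
  by apply: vle_lin (vpos_ge0 (- x)) _; lin_module R E; ring.
by apply: vle_lin (vle_vpos (- x)) _; lin_module R E; ring.
Qed.

Lemma vposBN x : vpos x - vpos (- x) = x.
Proof. by rewrite vposN; lin_module R E; ring. Qed.

Lemma vposZ (a : R) x : 0 <= a -> vpos (a *: x) = a *: vpos x.
Proof.
rewrite le_eqVlt => /orP[/eqP<-|a0]; first by rewrite !scale0r vpos0.
have le b y : 0 < b -> vpos (b *: y) <=v b *: vpos y.
  move=> b0; apply: vpos_lub; first exact: vleZ (ltW b0) (vle_vpos _).
  exact: vscale_ge0 _ _ (ltW b0) (vpos_ge0 _).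
apply: vle_eq; first exact: le.
have ai : 0 < a^-1 by rewrite invr_gt0.
have := vleZ (ltW a0) (le _ (a *: x) ai).
by rewrite !scalerA mulVf ?gt_eqF// mulfV ?gt_eqF// !scale1r.
Qed.

Lemma vmeetE x y : vmeet x y = x - vpos (x - y).
Proof.
apply: vle_eq; last first.
  apply: vmeet_glb; first exact: vle_subr (vpos_ge0 _).
  by apply: vle_lin (vle_vpos (x - y)) _; lin_module R E; ring.
have h : vpos (x - y) <=v x - vmeet x y.
  apply: vpos_lub; last exact: vle_sub0 (vmeet_lel _ _).
  by apply: vle_lin (vmeet_ler x y) _; lin_module R E; ring.
by apply: vle_lin h _; lin_module R E; ring.
Qed.

Lemma modulusE x : modulus x = vpos x + vpos (- x).
Proof.
apply: vle_eq.
  apply: vjoin_lub.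
    apply: vle_tr (vle_vpos x) _; exact: vle_addr (vpos_ge0 _).
  by rewrite addrC; apply: vle_tr (vle_vpos _) _; exact: vle_addr (vpos_ge0 _).
have h1 : 0 <=v x + modulus x.
  by apply: vle_lin (vle_joinr x (- x)) _; rewrite /modulus; lin_module R E; ring.
have h2 : 0 <=v - x + modulus x.
  by apply: vle_lin (vle_joinl x (- x)) _; rewrite /modulus; lin_module R E; ring.
have h3 : vpos (2 *: x) <=v x + modulus x.
  apply: vpos_lub h1.
  by apply: vle_lin h2 _; lin_module R E; ring.
rewrite vposZ// in h3.
by apply: vle_lin h3 _; rewrite vposN; lin_module R E; ring.
Qed.

Lemma modulus_ge0 x : 0 <=v modulus x.
Proof. by rewrite modulusE; exact: vadd_ge0 (vpos_ge0 _) (vpos_ge0 _). Qed.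

Lemma vle_modulus x : x <=v modulus x. Proof. exact: vle_joinl. Qed.
Lemma vleN_modulus x : - x <=v modulus x. Proof. exact: vle_joinr. Qed.
Lemma vpos_le_modulus x : vpos x <=v modulus x.
Proof. exact: vpos_lub (vle_modulus _) (modulus_ge0 _). Qed.

Lemma modulus_lub x z : x <=v z -> - x <=v z -> modulus x <=v z.
Proof. exact: vjoin_lub. Qed.

Lemma modulusN x : modulus (- x) = modulus x.
Proof. by rewrite !modulusE opprK addrC. Qed.

Lemma modulus_id x : 0 <=v x -> modulus x = x.
Proof.
move=> x0; apply: vle_eq (vle_modulus _); apply: modulus_lub (vle_refl _) _.
by apply: vle_lin (vadd_ge0 x0 x0) _; lin_module R E; ring.
Qed.

Lemma modulus0 : modulus 0 = 0 :> E. Proof. exact/modulus_id/vle_refl. Qed.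

Lemma modulusD x y : modulus (x + y) <=v modulus x + modulus y.
Proof.
apply: modulus_lub; first exact: vleD (vle_modulus _) (vle_modulus _).
by rewrite opprD; exact: vleD (vleN_modulus _) (vleN_modulus _).
Qed.

Lemma modulusZ (a : R) x : modulus (a *: x) = `|a| *: modulus x.
Proof.
wlog a0 : a / 0 <= a.
  move=> h; have [|/ltW] := leP 0 a; first exact: h.
  by rewrite -oppr_ge0 -normrN -modulusN -scaleNr; exact: h.
by rewrite ger0_norm// !modulusE -scalerN !vposZ// scalerDr.
Qed.

(** For positive elements this is disjointness; quantifying over lower bounds
    keeps it usable before any distributivity is known. *)
Definition vdisj u v := forall z, z <=v u -> z <=v v -> z <=v 0.

Lemma vdisj_sym u v : vdisj u v -> vdisj v u.
Proof. by move=> h z zv zu; exact: h. Qed.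

Lemma vdisj_mono u v u' v' : u' <=v u -> v' <=v v -> vdisj u v -> vdisj u' v'.
Proof. by move=> uu vv h z zu zv; apply: h; [exact: vle_tr uu|exact: vle_tr vv]. Qed.

Lemma vdisj_pos_neg x : vdisj (vpos x) (vpos (- x)).
Proof.
move=> z z1; rewrite vposN => z2.
have h : vpos x <=v vpos x - z.
  apply: vpos_lub; last exact: vle_sub0.
  by apply: vle_lin z2 _; lin_module R E; ring.
by apply: vle_lin h _; lin_module R E; ring.
Qed.

Lemma vdisj_add_le u v s : vdisj u v -> u <=v s -> v <=v s -> u + v <=v s.
Proof.
move=> uv us vs; suff h : u + v - s <=v 0 by apply: vle_lin h _; lin_module R E; ring.
by apply: uv; [apply: vle_lin vs _|apply: vle_lin us _]; lin_module R E; ring.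
Qed.

Lemma vdisjD u1 u2 v :
  0 <=v u2 -> vdisj u1 v -> vdisj u2 v -> vdisj (u1 + u2) v.
Proof.
move=> u20 h1 h2 z zu zv; apply: h2 (zv).
suff h : z - u2 <=v 0 by apply: vle_lin h _; lin_module R E; ring.
apply: h1; first by apply: vle_lin zu _; lin_module R E; ring.
by apply: vle_tr zv; exact: vle_subr.
Qed.

Lemma vdisjZ (a : R) u v : 0 <=v u -> 0 <=v v -> vdisj u v -> vdisj (a *: u) v.
Proof.
move=> u0 v0 uv; have := Num.Theory.archi_boundP (normr_ge0 a).
set n := Num.bound _ => an.
apply: (@vdisj_mono (n%:R *: u) v) (vle_refl _) _.
  by apply: vleZl u0; apply: le_trans (ler_norm _) (ltW an).
elim: n {an} => [|n IH]; first by rewrite scale0r => z.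
by rewrite -addn1 natrD scalerDl scale1r; exact: vdisjD.
Qed.

Lemma riesz_decomposition x y z : 0 <=v x -> 0 <=v y -> 0 <=v z -> z <=v x + y ->
  exists z1 z2, [/\ z = z1 + z2, 0 <=v z1 /\ z1 <=v x & 0 <=v z2 /\ z2 <=v y].
Proof.
move=> x0 y0 z0 zxy; exists (vmeet z x), (z - vmeet z x); split.
- by lin_module R E; ring.
- by split; [exact: vmeet_glb|exact: vmeet_ler].
split; first exact: vle_sub0 (vmeet_lel _ _).
rewrite vmeetE.
have h : vpos (z - x) <=v y.
  by apply: vpos_lub => //; apply: vle_lin zxy _; lin_module R E; ring.
by apply: vle_lin h _; lin_module R E; ring.
Qed.

(** * The lattice norm *)

Lemma norm_modulus x : `|modulus x| = `|x|.
Proof.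
have e := modulus_id (modulus_ge0 x); rewrite {1}/modulus in e.
by apply/eqP; rewrite eq_le !vnorm_le// e; exact: vle_refl.
Qed.

Lemma norm_mono x y : modulus x <=v y -> `|x| <= `|y|.
Proof.
by move=> xy; apply: vnorm_le; exact: vle_tr xy (vle_modulus _).
Qed.

Lemma norm_mono0 x y : 0 <=v x -> x <=v y -> `|x| <= `|y|.
Proof. by move=> x0 xy; apply: norm_mono; rewrite modulus_id. Qed.

Lemma norm_vpos x : `|vpos x| <= `|x|.
Proof.
rewrite -[leRHS]norm_modulus; apply: norm_mono0 (vpos_ge0 _) (vpos_le_modulus _).
Qed.

Lemma norm_vpos_le x y : x <=v y -> `|vpos x| <= `|y|.
Proof.
by move=> xy; apply: le_trans (norm_vpos y); exact: norm_mono0 (vpos_ge0 _) (vpos_mono _).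
Qed.

Lemma vle0_norm x : (forall eps : R, 0 < eps -> `|vpos x| <= eps) -> x <=v 0.
Proof.
move=> h; suff -> : 0 = vpos x by exact: vle_vpos.
by apply/esym/eqP; rewrite -normr_le0; apply/ler_addgt0Pl => eps /h; rewrite addr0.
Qed.

(** If [a <= z], then the positive part of [a - x] is at most [|z - x|]: order
    inequalities survive norm limits. *)
Lemma vle_closed a x :
  (forall eps : R, 0 < eps -> exists z, a <=v z /\ `|z - x| <= eps) -> a <=v x.
Proof.
move=> h; suff g : a - x <=v 0 by apply: vle_lin g _; lin_module R E; ring.
apply: vle0_norm => eps /h[z [az zx]]; apply: le_trans zx; apply: norm_vpos_le.
by apply: vle_lin az _; lin_module R E; ring.
Qed.

Lemma vge_closed a x :
  (forall eps : R, 0 < eps -> exists z, z <=v a /\ `|z - x| <= eps) -> x <=v a.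
Proof.
move=> h; suff g : - a <=v - x by apply: vle_lin g _; lin_module R E; ring.
apply: vle_closed => eps /h[z [az zx]]; exists (- z); split; first exact: vleN.
by rewrite -opprD normrN.
Qed.

Lemma vge_lim (u : nat -> E) (a l : E) :
  u @ \oo --> l -> (forall n, a <=v u n) -> a <=v l.
Proof.
move=> ul au; apply: vle_closed => eps eps0.
move/cvgrPdist_le: ul => /(_ _ eps0)[N _ /(_ N (leqnn _))] h.
by exists (u N); rewrite distrC.
Qed.

Lemma vle_lim (u : nat -> E) (a l : E) :
  u @ \oo --> l -> (forall n, u n <=v a) -> l <=v a.
Proof.
move=> ul au; apply: vge_closed => eps eps0.
move/cvgrPdist_le: ul => /(_ _ eps0)[N _ /(_ N (leqnn _))] h.
by exists (u N); rewrite distrC.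
Qed.

Lemma archimedean l x : (forall n : nat, n%:R *: l <=v x) -> l <=v 0.
Proof.
move=> h; apply: vle_closed => eps eps0.
have := Num.Theory.archi_boundP (divr_ge0 (normr_ge0 x) (ltW eps0)).
set n := Num.bound _ => an.
have n0 : 0 < n%:R :> R by apply: le_lt_trans an; rewrite divr_ge0// ltW.
exists (n%:R^-1 *: x); split.
  have := vleZ (ltW (_ : 0 < n%:R^-1)) (h n).
  by rewrite scalerA mulVf ?gt_eqF// scale1r; apply; rewrite invr_gt0.
rewrite subr0 normrZ ger0_norm ?invr_ge0 ?ler0n// ler_pdivrMl// -ler_pdivrMr//.
exact: ltW.
Qed.

End VectorLattice.

(** * Order completeness *)

Section OrderCompleteness.
Variables (R : realType) (E : banachLatticeType R).
Hypothesis hE : order_continuous_norm E.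
Implicit Types (x y z a b s : E) (A : set E).

Lemma cauchy_ex_cvg (u : nat -> E) :
  (forall eps : R, 0 < eps -> exists N, forall n m, (N <= n)%N -> (N <= m)%N ->
    `|u n - u m| <= eps) ->
  exists l : E, u @ \oo --> l.
Proof.
move=> h; apply/cvg_ex/cauchy_cvgP/cauchy_exP => eps eps0.
have e2 : 0 < eps / 2 by rewrite divr_gt0.
have [N hN] := h _ e2; exists (u N); exists N => // n /= Nn.
rewrite -ball_normE /=; apply: le_lt_trans (hN N n (leqnn _) Nn) _.
by rewrite ltr_pdivrMr// ltr_pMr// ltr1n.
Qed.

Definition vub A b := forall a, A a -> a <=v b.

Definition vlub A s := vub A s /\ forall b, vub A b -> s <=v b.

(** The differences between upper bounds and members of [A] decrease to 0,
    because subtracting a common lower bound of them from an upper bound leaves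
    an upper bound. *)
Lemma upper_gap_directed A b0 :
  A !=set0 -> (forall a a', A a -> A a' -> exists a2, [/\ A a2, a <=v a2 & a' <=v a2]) ->
  vub A b0 ->
  directed_to0 [set d | exists b a, [/\ vub A b, A a & d = b - a]].
Proof.
move=> [a0 Aa0] Adir ub0; split.
- by exists (b0 - a0), b0, a0.
- move=> _ _ [b1 [a1 [ub1 A1 ->]]] [b2 [a2 [ub2 A2 ->]]].
  have [a [Aa aa1 aa2]] := Adir _ _ A1 A2.
  exists (vmeet b1 b2 - a); split.
  + by exists (vmeet b1 b2), a; split=> // c Ac; apply: vmeet_glb; [exact: ub1|exact: ub2].
  + exact: vleD (vmeet_lel _ _) (vleN aa1).
  + exact: vleD (vmeet_ler _ _) (vleN aa2).
- by move=> _ [b [a [ub Aa ->]]]; exact/vle_sub0/ub.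
move=> l hl; apply: (@archimedean _ _ _ (b0 - a0)) => n.
suff h : vub A (b0 - n%:R *: l).
  by apply: vle_lin (h _ Aa0) _; lin_module R E; ring.
elim: n => [|n IH]; first by rewrite scale0r subr0.
move=> a Aa; have : l <=v b0 - n%:R *: l - a by apply: hl; exists (b0 - n%:R *: l), a.
by move=> h; apply: vle_lin h _; rewrite -addn1 natrD; lin_module R E; ring.
Qed.

(** Choosing members and upper bounds at small distance gives a Cauchy sequence,
    whose limit is the supremum, and which is therefore approached in norm. *)
Lemma directed_sup A b0 :
  A !=set0 -> (forall a a', A a -> A a' -> exists a2, [/\ A a2, a <=v a2 & a' <=v a2]) ->
  vub A b0 ->
  exists2 s, vlub A s & forall eps : R, 0 < eps ->
    exists a, A a /\ forall a', A a' -> a <=v a' -> `|s - a'| <= eps.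
Proof.
move=> A0 Adir ub0.
have gap (eps : R) : 0 < eps -> exists p : E * E, [/\ A p.1, vub A p.2 &
    forall a', A a' -> p.1 <=v a' -> `|p.2 - a'| <= eps].
  move=> eps0.
  have [_ [[b [a [ub Aa ->]]] h]] := hE (upper_gap_directed A0 Adir ub0) eps0.
  exists (a, b); split=> // a' Aa' aa'; apply/ltW/h; first by exists b, a'.
  exact: vleD (vle_refl _) (vleN aa').
have hpos (n : nat) : 0 < n.+1%:R^-1 :> R by rewrite invr_gt0.
have [p hp] := choice (fun n => gap _ (hpos n)).
have small (eps : R) : 0 < eps ->
    exists N, forall n, (N <= n)%N -> n.+1%:R^-1 <= eps.
  move=> e0; exists (Num.bound eps^-1) => n Nn.
  rewrite invf_ple ?posrE//.
  apply/ltW/(lt_le_trans (Num.Theory.archi_boundP _)); first by rewrite invr_ge0 ltW.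
  by rewrite ler_nat ltnW.
have ab n a' : A a' -> (p n).1 <=v a' -> `|a' - (p n).1| <= n.+1%:R^-1.
  move=> Aa' le; have [A1 ub2 g] := hp n; apply: le_trans (g _ A1 (vle_refl _)).
  by apply: norm_mono0 (vle_sub0 le) _; apply: vleD (vle_refl _); exact: ub2.
have [s sl] : exists s : E, (fun n => (p n).1) @ \oo --> s.
  apply: cauchy_ex_cvg => eps eps0.
  have [N hN] := small _ (divr_gt0 eps0 (ltr0n _ 2)).
  exists N => n m /hN hn /hN hm.
  have [A1 _ _] := hp n; have [A2 _ _] := hp m.
  have [a [Aa a1 a2]] := Adir _ _ A1 A2.
  have -> : (p n).1 - (p m).1 = (a - (p m).1) - (a - (p n).1).
    by lin_module R E; ring.
  apply: le_trans (ler_normB _ _) _.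
  by rewrite [eps]splitr; apply: lerD; [exact: le_trans (ab _ _ Aa a2) hm|
    exact: le_trans (ab _ _ Aa a1) hn].
have key (eps : R) : 0 < eps -> exists a b, [/\ A a, vub A b, `|b - s| <= eps &
    forall a', A a' -> a <=v a' -> `|b - a'| <= eps].
  move=> eps0; have e2 : 0 < eps / 2 by rewrite divr_gt0.
  have [N hN] := small _ e2.
  move/cvgrPdist_le: sl => /(_ _ e2)[N' _ hN'].
  have {hN}h1 := hN _ (leq_maxl N N').
  have {hN'} /= h2 := hN' _ (leq_maxr N N').
  set n := maxn N N' in h1 h2; have [A1 ub g] := hp n.
  exists (p n).1, (p n).2; split=> //.
    have -> : (p n).2 - s = (p n).2 - (p n).1 - (s - (p n).1).
      by lin_module R E; ring.
    apply: le_trans (ler_normB _ _) _; rewrite [eps]splitr; apply: lerD h2.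
    exact: le_trans (g _ A1 (vle_refl _)) h1.
  move=> a' Aa' aa'; apply: le_trans (g _ Aa' aa') (le_trans h1 _).
  by rewrite ler_pdivrMr// ler_pMr// ler1n.
exists s; first split.
- move=> a Aa; apply: vle_closed => eps /key[_ [b [_ ub bs _]]].
  by exists b; split => //; exact: ub.
- move=> b ub; apply: vle_lim sl _ => n; apply: ub; by have [] := hp n.
- move=> eps eps0; have [a [b [Aa ub bs h]]] := key _ (divr_gt0 eps0 (ltr0n _ 2)).
  exists a; split=> // a' Aa' aa'.
  have -> : s - a' = b - a' - (b - s) by lin_module R E; ring.
  apply: le_trans (ler_normB _ _) _; rewrite [eps]splitr.
  by apply: lerD bs; exact: h.
Qed.

(** The finite joins of the members of [A] form a directed set with the same
    upper bounds. *)
Lemma order_complete A b0 : A !=set0 -> vub A b0 -> exists s, vlub A s.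
Proof.
move=> [a0 Aa0] ub0.
pose J : set E := [set z | forall B : set E, A `<=` B ->
  (forall x y, B x -> B y -> B (vjoin x y)) -> B z].
have AJ : A `<=` J by move=> a Aa B AB _; exact: AB.
have ubJ b : vub A b -> vub J b.
  move=> ub z /(_ [set z | z <=v b]); apply => [a /ub//|x y]; exact: vjoin_lub.
have [||s [ubs lubs] _] := @directed_sup J b0 _ _ (ubJ _ ub0).
- by exists a0; exact: AJ.
- move=> a a' Ja Ja'; exists (vjoin a a'); split; [|exact: vle_joinl|exact: vle_joinr].
  by move=> B AB Bj; exact: (Bj _ _ (Ja B AB Bj) (Ja' B AB Bj)).
by exists s; split=> [a /AJ/ubs//|b /ubJ/lubs].
Qed.

Lemma increasing_cvg (u : nat -> E) b :
  (forall n, u n <=v u n.+1) -> (forall n, u n <=v b) ->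
  exists2 s, u @ \oo --> s & forall n, u n <=v s.
Proof.
move=> um ub.
have mono n m : (n <= m)%N -> u n <=v u m.
  move=> /subnK <-; elim: (m - n)%N => [|k IH]; first exact: vle_refl.
  exact: vle_tr IH (um _).
have [||_ [n _ <-]|s [ubs _] h] := @directed_sup (range u) b.
- by exists (u 0%N), 0%N.
- move=> _ _ [n _ <-] [m _ <-]; exists (u (maxn n m)); split.
  + by exists (maxn n m).
  + exact/mono/leq_maxl.
  + exact/mono/leq_maxr.
- exact: ub.
exists s => [|n]; last by apply: ubs; exists n.
apply/cvgrPdist_le => eps /h[_ [[N _ <-] hN]].
by exists N => // n /= Nn; apply: hN; [exists n|exact: mono].
Qed.

Lemma decreasing_cvg (u : nat -> E) b :
  (forall n, u n.+1 <=v u n) -> (forall n, b <=v u n) ->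
  exists2 s, u @ \oo --> s & forall n, s <=v u n.
Proof.
move=> um ub.
have [n|n|s us hs] := @increasing_cvg (fun n => - u n) (- b).
- exact/vleN.
- exact/vleN.
exists (- s); first by rewrite (_ : u = fun n => - - u n); [exact: cvgN|
  by apply/funext => n; rewrite opprK].
by move=> n; rewrite -[u n]opprK; exact: vleN.
Qed.

End OrderCompleteness.

(** * Linear functionals below a sublinear one *)

Section HahnBanach.
Variables (R : realType) (V : lmodType R).
Implicit Types (p q : V -> R) (x y : V).

Definition sublinear q := (forall x y, q (x + y) <= q x + q y) /\
  (forall (a : R) x, 0 <= a -> q (a *: x) <= a * q x).

Lemma sublinear0 q : sublinear q -> q 0 = 0.
Proof.
move=> [qD qZ]; have := qD 0 0; have := qZ 0 0 (lexx _); rewrite addr0 scale0r.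
by lra.
Qed.

Lemma sublinear_oppr q x : sublinear q -> - q (- x) <= q x.
Proof.
by move=> sq; have := sq.1 x (- x); rewrite subrr sublinear0//; lra.
Qed.

(** The largest sublinear functional below [q] whose value at [- y] is [- q y]. *)
Definition affine_along q y x :=
  inf [set q (x + t *: y) - t * q y | t in [set t : R | 0 <= t]].

Lemma affine_along_has_inf q y x : sublinear q ->
  has_inf [set q (x + t *: y) - t * q y | t in [set t : R | 0 <= t]].
Proof.
move=> sq; split; first by exists (q (x + 0 *: y) - 0 * q y), 0 => //=.
exists (- q (- x)) => _ [t /= t0 <-].
have := sq.1 (x + t *: y) (- x).
rewrite (_ : _ + _ - x = t *: y); last by lin_module R V; ring.
have := sq.1 (t *: y) (- (t *: y)).
have : t * q y <= q (t *: y).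
  move: t0; rewrite le_eqVlt => /orP[/eqP<-|t0].
    by rewrite scale0r mul0r sublinear0.
  rewrite -ler_pdivlMl//; have ti : 0 <= t^-1 by rewrite invr_ge0 ltW.
  by have := sq.2 _ (t *: y) ti; rewrite scalerA mulVf ?gt_eqF// scale1r.
by move: (q _) (q _) (q _) (q _) (q _) (q _) => *; lra.
Qed.

Lemma affine_along_le q y x (t : R) : sublinear q -> 0 <= t ->
  affine_along q y x <= q (x + t *: y) - t * q y.
Proof.
by move=> sq t0; apply: ge_inf; [exact: (affine_along_has_inf _ _ sq).2|exists t].
Qed.

Lemma affine_along_ge q y x c : sublinear q ->
  (forall t, 0 <= t -> c <= q (x + t *: y) - t * q y) -> c <= affine_along q y x.
Proof.
move=> sq h; apply: lb_le_inf; first exact: (affine_along_has_inf _ _ sq).1.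
by move=> _ [t /= t0 <-]; exact: h.
Qed.

Lemma affine_along_sublinear q y : sublinear q -> sublinear (affine_along q y).
Proof.
move=> sq; split=> [x x'|a x].
  rewrite -lerBlDr; apply: affine_along_ge => // t t0.
  rewrite lerBlDr -lerBlDl; apply: affine_along_ge => // s s0.
  have := affine_along_le y (x + x') sq (addr_ge0 t0 s0).
  have := sq.1 (x + t *: y) (x' + s *: y).
  rewrite (_ : x + t *: y + (x' + s *: y) = x + x' + (t + s) *: y); last first.
    by lin_module R V; ring.
  by rewrite mulrDl; move: (q _) (q _) (q _) (t * _) (s * _) => *; lra.
rewrite le_eqVlt => /orP[/eqP<-|a0].
  rewrite scale0r mul0r; apply: le_trans (affine_along_le _ _ sq (lexx 0)) _.
  by rewrite scale0r addr0 mul0r subr0 sublinear0.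
rewrite -ler_pdivrMl//; apply: affine_along_ge => // t t0.
rewrite ler_pdivrMl//; have at0 := mulr_ge0 (ltW a0) t0.
have := affine_along_le y (a *: x) sq at0.
have := sq.2 _ (x + t *: y) (ltW a0).
by rewrite scalerDr scalerA mulrBr mulrA; move: (q _) (q _) => *; lra.
Qed.

Lemma affine_along_leq q y x : sublinear q -> affine_along q y x <= q x.
Proof.
move=> sq; apply: le_trans (affine_along_le _ _ sq (lexx 0)) _.
by rewrite scale0r addr0 mul0r subr0.
Qed.

Lemma affine_along_opp q y : sublinear q -> affine_along q y (- y) <= - q y.
Proof.
move=> sq; apply: le_trans (affine_along_le _ _ sq ler01) _.
by rewrite scale1r addNr sublinear0// mul1r sub0r.
Qed.

(** Zorn's lemma applies because the pointwise infimum of a chain of sublinear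
    functionals is sublinear. *)
Lemma minimal_sublinear p : sublinear p ->
  exists m, [/\ sublinear m, (forall x, m x <= p x) &
    forall q, sublinear q -> (forall x, q x <= m x) -> q = m].
Proof.
move=> sp; pose T := {q : V -> R | sublinear q /\ forall x, q x <= p x}.
pose rT (s t : T) := `[< forall x, sval t x <= sval s x >].
have [|||C totC|[m [sm mp]] hm] := @Zorn T rT.
- by move=> t; apply/asboolP => x.
- move=> r s t /asboolP rs /asboolP st; apply/asboolP => x.
  exact: le_trans (st x) (rs x).
- move=> [s hs] [t ht] /asboolP /= st /asboolP /= ts; apply: eq_exist.
  by apply/funext => x; apply/eqP; rewrite eq_le st ts.
- have [[t0 Ct0]|C0] := pselect (exists t, C t); last first.
    by exists (exist _ p (conj sp (fun=> lexx _))) => s Cs; case: C0; exists s.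
  pose F x := [set sval t x | t in C].
  have Fi x : has_inf (F x).
    split; first by exists (sval t0 x), t0.
    exists (- p (- x)) => _ [t _ <-]; have [st tp] := proj2_sig t.
    by apply: le_trans (sublinear_oppr _ st); rewrite lerN2.
  have Fle t x : C t -> inf (F x) <= sval t x.
    by move=> Ct; apply: ge_inf; [exact: (Fi x).2|exists t].
  have Fge c x : (forall t, C t -> c <= sval t x) -> c <= inf (F x).
    by move=> h; apply: lb_le_inf; [exact: (Fi x).1|move=> _ [t Ct <-]; exact: h].
  have Fsub : sublinear (fun x => inf (F x)).
    split=> [x y|a x].
      rewrite -lerBlDr; apply: (Fge) => t Ct; rewrite lerBlDr -lerBlDl.
      apply: (Fge) => s Cs; have [st _] := proj2_sig t; have [ss _] := proj2_sig s.
      rewrite lerBlDr; have [/asboolP ts|/asboolP ts] := totC _ _ Ct Cs.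
        apply: le_trans (Fle _ _ Cs) _; apply: le_trans (ss.1 _ _) _.
        by rewrite addrC lerD.
      apply: le_trans (Fle _ _ Ct) _; apply: le_trans (st.1 _ _) _.
      by rewrite addrC lerD.
    move=> a0; move: (a0); rewrite le_eqVlt => /orP[/eqP<-|a1].
      rewrite scale0r mul0r; apply: le_trans (Fle _ _ Ct0) _.
      by rewrite sublinear0//; have [] := proj2_sig t0.
    rewrite -ler_pdivrMl//; apply: (Fge) => t Ct; rewrite ler_pdivrMl//.
    apply: le_trans (Fle _ _ Ct) _; have [st _] := proj2_sig t; exact: st.2.
  have Fp x : inf (F x) <= p x.
    by apply: le_trans (Fle _ _ Ct0) _; have [_] := proj2_sig t0.
  exists (exist _ (fun x => inf (F x)) (conj Fsub Fp) : T) => s Cs; apply/asboolP => x; exact: Fle.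
exists m; split=> // q sq qm.
have qp x : q x <= p x by exact: le_trans (qm x) (mp x).
have /(_ _)/(congr1 sval) := hm (exist _ q (conj sq qp) : T); apply.
exact/asboolP.
Qed.

(** A minimal sublinear functional is odd, hence linear, since it cannot be lowered
    at [- y] for any [y]. Minimizing below [affine_along p x0] instead of [p] keeps
    the value at [x0]. *)
Lemma hahn_banach p x0 : sublinear p ->
  exists f : {scalar V}, (forall x, f x <= p x) /\ f x0 = p x0.
Proof.
move=> sp; have [m [sm mp mmin]] := minimal_sublinear (affine_along_sublinear x0 sp).
have mN x : m (- x) = - m x.
  have e : affine_along m x = m.
    by apply: mmin => [|y]; [exact: affine_along_sublinear|exact: affine_along_leq].
  apply/eqP; rewrite eq_le -{1}e affine_along_opp//=.
  by rewrite lerNl sublinear_oppr.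
have mlin : linear_for *%R m.
  have mD x y : m (x + y) = m x + m y.
    apply/eqP; rewrite eq_le sm.1 -lerN2 -mN opprD /=.
    by have := sm.1 (- x) (- y); rewrite !mN; lra.
  have mZ a x : 0 <= a -> m (a *: x) = a * m x.
    move=> a0; apply/eqP; rewrite eq_le sm.2//= -lerN2 -mN -scalerN -mulrN -mN.
    exact: sm.2.
  move=> a x y; rewrite mD; congr (_ + _).
  have [|a0] := leP 0 a; first exact: mZ.
  have na0 : 0 <= - a by rewrite oppr_ge0 ltW.
  by rewrite -[a]opprK scaleNr mN mZ// -mulNr.
pose f : {scalar V} := HB.pack m (GRing.isLinear.Build R V R *%R m mlin).
have mle x : m x <= p x by exact: le_trans (mp x) (affine_along_leq _ _ sp).
exists f; split=> //; apply/eqP; rewrite eq_le [f _ <= _]mle /=.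
rewrite -lerN2 -[- _]/(- (m x0)) -mN; apply: le_trans (mp _) _.
exact: affine_along_opp.
Qed.

End HahnBanach.

(** * Positive operators *)

Section PositiveOperators.
Variables (R : realType) (E : banachLatticeType R).
Implicit Types (x y z u v : E).

(* Linearity restated for endomorphisms, to serve as rewrite rules. *)
Lemma opD (A : {linear E -> E}) x y : A (x + y) = A x + A y.
Proof. exact: linearD. Qed.
Lemma opB (A : {linear E -> E}) x y : A (x - y) = A x - A y.
Proof. exact: linearB. Qed.
Lemma opN (A : {linear E -> E}) x : A (- x) = - A x.
Proof. exact: linearN. Qed.
Lemma opZ (A : {linear E -> E}) (a : R) x : A (a *: x) = a *: A x.
Proof. exact: linearZ. Qed.

Section Monotone.
Variables (A : {linear E -> E}) (Apos : positive_op A).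

Lemma posop_mono x y : x <=v y -> A x <=v A y.
Proof.
by move=> /vle_sub0/Apos; rewrite linearB => /= h; apply: vle_lin h _; lin_module R E; ring.
Qed.

Lemma posop_modulus x : modulus (A x) <=v A (modulus x).
Proof.
apply: modulus_lub; first exact/posop_mono/vle_modulus.
by rewrite -linearN; exact/posop_mono/vleN_modulus.
Qed.

Lemma posop_vpos x : vpos (A x) <=v A (vpos x).
Proof.
by apply: vpos_lub; [exact/posop_mono/vle_vpos|exact/Apos/vpos_ge0].
Qed.

End Monotone.

Lemma bounded_continuous (W : normedModType R) (A : {linear E -> W}) (C : R) :
  (forall x, `|A x| <= C * `|x|) -> continuous A.
Proof.
move=> h; apply: bounded_linear_continuous; apply/linear_boundedP.
near=> r => x; apply: le_trans (h x) _; apply: ler_wpM2r => //.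
Unshelve. all: by end_near. Qed.

Lemma bounded_cvg (W : normedModType R) (A : {linear E -> W}) (C : R)
  (u : nat -> E) (l : E) :
  (forall x, `|A x| <= C * `|x|) -> u @ \oo --> l -> (fun n => A (u n)) @ \oo --> A l.
Proof. by move=> h ul; apply: continuous_cvg ul; exact: (bounded_continuous h). Qed.

Lemma iter_is_linear (T : {linear E -> E}) n : linear (iter n T).
Proof. by elim: n => [|n IH] a x y //=; rewrite IH linearP. Qed.

HB.instance Definition _ (T : {linear E -> E}) n :=
  GRing.isLinear.Build R E E *:%R (iter n T) (iter_is_linear T n).

Lemma iter_pos (T : {linear E -> E}) n : positive_op T -> positive_op (iter n T).
Proof. by move=> Tp; elim: n => [|n IH] x x0 //=; exact/Tp/IH. Qed.

Lemma power_bounded_bound (T : {linear E -> E}) : power_bounded T ->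
  exists2 C : R, 0 <= C & forall n x, `|iter n T x| <= C * `|x|.
Proof.
rewrite /power_bounded; set s := ereal_sup _ => sfin.
have ub n x : `|x| <= 1 -> (`|iter n T x|%:E <= s)%E.
  move=> x1; apply: le_trans (ereal_sup_ubound _); last by exists n.
  by apply: ereal_sup_ubound; exists x.
have s0 : (0 <= s)%E by apply: le_trans (ub 0%N 0 _); rewrite ?lee_fin ?normr0.
have sE : s = (fine s)%:E by rewrite fineK// ge0_fin_numE.
exists (fine s); first by rewrite -lee_fin -sE.
move=> n x; have [->|x0] := eqVneq x 0; first by rewrite linear0 normr0 mulr0.
have nx : 0 < `|x| by rewrite normr_gt0.
have := ub n (`|x|^-1 *: x); rewrite sE lee_fin linearZ /= !normrZ.
rewrite ger0_norm ?invr_ge0// mulVf ?gt_eqF// lexx => /(_ isT).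
by rewrite ler_pdivrMl// mulrC.
Qed.

End PositiveOperators.

(** * Invariant functionals *)

Section InvariantFunctional.
Variables (R : realType) (E : banachLatticeType R) (T : {linear E -> E}) (C : R).
Hypothesis Tpos : positive_op T.
Hypothesis TC : forall n x, `|iter n T x| <= C * `|x|.
Implicit Types (x y z u v : E).

Definition psum n x : E := \sum_(i < n) iter i T x.
Definition cesaro n x : E := n%:R^-1 *: psum n x.

Lemma psum_linear n : linear (psum n).
Proof.
move=> a x y; rewrite /psum scaler_sumr -big_split /=.
by apply: eq_bigr => i _; rewrite linearP.
Qed.

HB.instance Definition _ n :=
  GRing.isLinear.Build R E E *:%R (psum n) (psum_linear n).

Lemma cesaro_linear n : linear (cesaro n).
Proof.
by move=> a x y; rewrite /cesaro linearP scalerDr !scalerA mulrC.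
Qed.

HB.instance Definition _ n :=
  GRing.isLinear.Build R E E *:%R (cesaro n) (cesaro_linear n).

Lemma psumS n x : psum n.+1 x = psum n x + iter n T x.
Proof. by rewrite /psum big_ord_recr. Qed.

Lemma psumSl n x : psum n.+1 x = x + T (psum n x).
Proof.
by rewrite /psum big_ord_recl /= linear_sum.
Qed.

Lemma psum_pos n : positive_op (psum n).
Proof. by move=> x x0; apply: vsum_ge0 => i _; exact: iter_pos. Qed.

Lemma cesaro_pos n : positive_op (cesaro n).
Proof. by move=> x x0; apply: vscale_ge0; [rewrite invr_ge0|exact: psum_pos]. Qed.

Lemma psum_id_sub n x : psum n (x - T x) = x - iter n T x.
Proof.
elim: n => [|n IH]; first by rewrite /psum big_ord0 subrr.
rewrite psumS IH linearB /= -iterSr /=; lin_module R E; ring.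
Qed.

Lemma C_norm_ge0 x : 0 <= C * `|x|.
Proof. exact: le_trans (normr_ge0 _) (TC 0 x). Qed.

Lemma cesaro_bound n x : `|cesaro n x| <= C * `|x|.
Proof.
have [->|n0] := posnP n.
  by rewrite /cesaro /psum big_ord0 scaler0 normr0 C_norm_ge0.
rewrite normrZ ger0_norm ?invr_ge0// ler_pdivrMl ?ltr0n//.
apply: le_trans (ler_norm_sum _ _ _) _.
apply: le_trans (ler_sum _ (fun (i : 'I_n) _ => TC i x)) _.
by rewrite sumr_const card_ord mulr_natl.
Qed.

Lemma cesaro_sub_cvg0 x (eps : R) : 0 < eps ->
  exists N, forall n, (N <= n)%N -> `|cesaro n (x - T x)| <= eps.
Proof.
move=> eps0; set K := `|x| + C * `|x|.
have K0 : 0 <= K / eps.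
  apply: divr_ge0 (ltW eps0); apply: addr_ge0 => //; exact: C_norm_ge0.
exists (Num.bound (K / eps)).+1 => n Nn.
have n0 : 0 < n%:R :> R by rewrite ltr0n; case: n Nn.
rewrite /cesaro psum_id_sub normrZ ger0_norm ?invr_ge0// ler_pdivrMl//.
apply: (@le_trans _ _ K).
  by apply: le_trans (ler_normB _ _) _; rewrite lerD2l.
rewrite -ler_pdivrMr//; apply/ltW/(lt_le_trans (Num.Theory.archi_boundP K0)).
by rewrite ler_nat ltnW.
Qed.

(** The asymptotic size of the positive parts of the Cesaro means. A linear
    functional below it is positive, because the means of a negative vector have
    no positive part, and invariant, because the means of [x - T x] vanish
    asymptotically. *)
Definition asymptotic_size x : R :=
  inf [set t | exists N, forall n, (N <= n)%N -> `|vpos (cesaro n x)| <= t].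

Lemma asymptotic_size_has_inf x :
  has_inf [set t | exists N, forall n, (N <= n)%N -> `|vpos (cesaro n x)| <= t].
Proof.
split.
  exists (C * `|x|), 0%N => n _.
  exact: le_trans (norm_vpos _) (cesaro_bound _ _).
by exists 0 => t [N /(_ N (leqnn _))]; exact: le_trans.
Qed.

Lemma asymptotic_size_le x t :
  (exists N, forall n, (N <= n)%N -> `|vpos (cesaro n x)| <= t) -> asymptotic_size x <= t.
Proof. by move=> h; apply: ge_inf => //; exact: (asymptotic_size_has_inf x).2. Qed.

Lemma asymptotic_size_ge x c :
  (forall t N, (forall n, (N <= n)%N -> `|vpos (cesaro n x)| <= t) -> c <= t) ->
  c <= asymptotic_size x.
Proof.
move=> h; apply: lb_le_inf; first exact: (asymptotic_size_has_inf x).1.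
by move=> t [N hN]; exact: h hN.
Qed.

Lemma asymptotic_size_sublinear : sublinear asymptotic_size.
Proof.
split=> [x y|a x].
  rewrite -lerBlDr; apply: asymptotic_size_ge => t N hN.
  rewrite lerBlDr -lerBlDl; apply: asymptotic_size_ge => s M hM.
  rewrite lerBlDl; apply: asymptotic_size_le; exists (maxn N M) => n.
  rewrite geq_max => /andP[/hN hn /hM hm]; apply: le_trans (lerD hn hm).
  apply: le_trans (ler_normD _ _); apply: norm_mono0 (vpos_ge0 _) _.
  by rewrite linearD; exact: vposD.
rewrite le_eqVlt => /orP[/eqP<-|a0].
  rewrite scale0r mul0r; apply: asymptotic_size_le; exists 0%N => n _.
  by rewrite linear0 vpos0 normr0.
rewrite -ler_pdivrMl//; apply: asymptotic_size_ge => t N hN; rewrite ler_pdivrMl//.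
apply: asymptotic_size_le; exists N => n /hN hn.
by rewrite linearZ /= (vposZ _ (ltW a0)) normrZ gtr0_norm// ler_pM2l.
Qed.

Lemma asymptotic_size_bound x : asymptotic_size x <= C * `|x|.
Proof.
apply: asymptotic_size_le; exists 0%N => n _.
exact: le_trans (norm_vpos _) (cesaro_bound _ _).
Qed.

Lemma asymptotic_size_sub x : asymptotic_size (x - T x) <= 0.
Proof.
apply/ler_addgt0Pl => eps eps0; rewrite addr0; apply: asymptotic_size_le.
have [N hN] := cesaro_sub_cvg0 x eps0; exists N => n /hN.
exact: le_trans (norm_vpos _).
Qed.

Lemma asymptotic_size_neg x : 0 <=v x -> asymptotic_size (- x) <= 0.
Proof.
move=> x0; apply: asymptotic_size_le; exists 0%N => n _.
suff -> : vpos (cesaro n (- x)) = 0 by rewrite normr0.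
apply: vle_eq (vpos_ge0 _); apply: vpos_lub (vle_refl _).
by rewrite linearN -[0]oppr0; apply: vleN; exact: cesaro_pos.
Qed.

Lemma asymptotic_size_subfixed x : 0 <=v x -> x <=v T x -> `|x| <= asymptotic_size x.
Proof.
move=> x0 xT; apply: asymptotic_size_ge => t N /(_ N.+1 (leqnSn _)); apply: le_trans.
have ih n : x <=v iter n T x.
  elim: n => [|n IH]; first exact: vle_refl.
  by apply: vle_tr xT _; exact: posop_mono.
have h : x <=v cesaro N.+1 x.
  have : N.+1%:R *: x <=v psum N.+1 x.
    elim: N.+1 => [|n IH].
      by rewrite scale0r /psum big_ord0; exact: vle_refl.
    rewrite psumS -[n.+1]addn1 natrD scalerDl scale1r; exact: vleD.
  have ni : 0 <= N.+1%:R^-1 :> R by rewrite invr_ge0.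
  by move=> /(vleZ ni); rewrite scalerA mulVf ?scale1r// pnatr_eq0.
by apply: norm_mono0 => //; exact: vle_tr (vle_vpos _).
Qed.

Lemma invariant_functional x : 0 <=v x -> x != 0 -> x <=v T x ->
  exists phi : {scalar E}, [/\ forall y, 0 <=v y -> 0 <= phi y,
    forall y, phi (T y) = phi y, forall y, `|phi y| <= C * `|y| & 0 < phi x].
Proof.
move=> x0 xn0 xT; have [phi [phi_le phix]] := hahn_banach x asymptotic_size_sublinear.
exists phi; split.
- by move=> y y0; have := phi_le (- y); rewrite linearN; have := asymptotic_size_neg y0; lra.
- move=> y; have := phi_le (y - T y); have := phi_le (- y - T (- y)).
  have := asymptotic_size_sub y; have := asymptotic_size_sub (- y).
  by rewrite !linearB /= !linearN /= !linearN /=; lra.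
- move=> y; rewrite ler_norml; apply/andP; split; last first.
    exact: le_trans (phi_le _) (asymptotic_size_bound _).
  by rewrite lerNl -linearN -normrN; exact: le_trans (phi_le _) (asymptotic_size_bound _).
- by rewrite phix; apply: lt_le_trans (asymptotic_size_subfixed x0 xT); rewrite normr_gt0.
Qed.

End InvariantFunctional.

(** * Quasi-interior points *)

Section QuasiInterior.
Variables (R : realType) (E : banachLatticeType R).
Implicit Types (x y z u v : E).

Lemma norm_closed (J : set E) :
  (forall x, (forall eps : R, 0 < eps -> exists z, J z /\ `|z - x| <= eps) -> J x) ->
  closed J.
Proof.
move=> h x clx; apply: h => eps e0.
have [z [Jz]] := clx _ (nbhsx_ballx x eps e0).
by rewrite -ball_normE /= distrC => /ltW zx; exists z.
Qed.

(** The elements that are norm limits of their truncations by multiples of [u]: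
    this is the closed ideal generated by [u], in a form that makes solidity and
    closedness immediate. *)
Definition closed_ideal u : set E :=
  [set x | forall eps : R, 0 < eps ->
    exists n : nat, `|vpos (modulus x - n%:R *: u)| <= eps].

Lemma closed_idealP u : 0 <=v u -> lattice_ideal (closed_ideal u).
Proof.
move=> u0.
have J0 : closed_ideal u 0.
  move=> eps e0; exists 0%N.
  by rewrite modulus0 scale0r subr0 vpos0 normr0 ltW.
have solid x y : closed_ideal u y -> modulus x <=v modulus y -> closed_ideal u x.
  move=> Jy xy eps /Jy[n hn]; exists n; apply: le_trans hn.
  apply: norm_mono0 (vpos_ge0 _) (vpos_mono _).
  exact: vleD xy (vle_refl _).
have add x y : closed_ideal u x -> closed_ideal u y -> closed_ideal u (x + y).
  move=> Jx Jy eps e0; have e2 : 0 < eps / 2 by rewrite divr_gt0.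
  have [[n hn] [m hm]] := (Jx _ e2, Jy _ e2); exists (n + m)%N.
  rewrite [eps]splitr; apply: le_trans (lerD hn hm).
  apply: le_trans (ler_normD _ _); apply: norm_mono0 (vpos_ge0 _) _.
  apply: vle_tr (vposD _ _); apply: vpos_mono.
  by apply: vle_lin (modulusD x y) _; rewrite natrD; lin_module R E; ring.
split=> // a x Jx.
have := Num.Theory.archi_boundP (normr_ge0 a); set n := Num.bound _ => an.
have Jn : closed_ideal u (n%:R *: x).
  elim: n {an} => [|n IH]; first by rewrite scale0r.
  by rewrite -addn1 natrD scalerDl scale1r; exact: add.
apply: (solid _ _ Jn); rewrite !modulusZ normr_nat.
by apply: vleZl (modulus_ge0 _); exact: ltW.
Qed.

Lemma closed_ideal_closed u : closed (closed_ideal u).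
Proof.
apply: norm_closed => x h eps e0; have e2 : 0 < eps / 2 by rewrite divr_gt0.
have [z [Jz zx]] := h _ e2; have [n hn] := Jz _ e2; exists n.
rewrite [eps]splitr; apply: le_trans (lerD hn zx).
rewrite -[`|z - x|]norm_modulus; apply: le_trans (ler_normD _ _).
apply: norm_mono0 (vpos_ge0 _) _.
apply: vpos_lub (vadd_ge0 (vpos_ge0 _) (modulus_ge0 _)).
apply: vle_tr (vleD (vle_vpos _) (vle_refl _)).
have := modulusD z (x - z); rewrite (_ : z + (x - z) = x); last by lin_module R E; ring.
rewrite -[modulus (x - z)]modulusN opprB => h'.
by apply: vle_lin h' _; lin_module R E; ring.
Qed.

Lemma closed_ideal_self u : 0 <=v u -> closed_ideal u u.
Proof.
move=> u0 eps e0; exists 1%N.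
by rewrite modulus_id// scale1r subrr vpos0 normr0 ltW.
Qed.

Definition full_ideal u := forall x, closed_ideal u x.

Lemma full_ideal_quasi_interior u : 0 <=v u -> full_ideal u -> quasi_interior u.
Proof.
move=> u0 full; split=> // O [x Ox] oO.
have [eps /= e0 xO] : exists2 e : R, 0 < e & ball x e `<=` O.
  exact/nbhs_ballP/open_nbhs_nbhs.
have e4 : 0 < eps / 3 by rewrite divr_gt0.
have [n hn] := full x _ e4.
pose tr y := vmeet y (n.+1%:R *: u).
have nu0 : 0 <=v n.+1%:R *: u by exact: vscale_ge0.
have gap y : y <=v modulus x -> `|vpos (y - n.+1%:R *: u)| <= eps / 3.
  move=> yx; apply: le_trans hn; apply: norm_mono0 (vpos_ge0 _) (vpos_mono _).
  by apply: vleD yx (vleN _); apply: vleZl u0; rewrite ler_nat.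
exists (tr (vpos x) - tr (vpos (- x))); split.
  apply: xO; rewrite -ball_normE /=.
  rewrite (_ : _ - _ = vpos (vpos x - n.+1%:R *: u) - vpos (vpos (- x) - n.+1%:R *: u));
    last by rewrite /tr !vmeetE -{1}(vposBN x); lin_module R E; ring.
  apply: le_lt_trans (ler_normB _ _) _.
  apply: (@le_lt_trans _ _ (eps / 3 + eps / 3)); last by lra.
  apply: lerD; apply: gap; first exact: vpos_le_modulus.
  by rewrite -modulusN; exact: vpos_le_modulus.
exists n.+1%:R; split; first by rewrite ltr0n.
have tr0 y : 0 <=v y -> 0 <=v tr y by move=> y0; exact: vmeet_glb.
apply: modulus_lub.
  apply: vle_tr (vmeet_ler _ _); exact: vle_subr (tr0 _ (vpos_ge0 _)).
rewrite opprB; apply: vle_tr (vmeet_ler _ _); exact: vle_subr (tr0 _ (vpos_ge0 _)).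
Qed.

Lemma quasi_interior_full_ideal u : quasi_interior u -> full_ideal u.
Proof.
move=> [u0 du] x eps e0.
have [z [xz [c [c0 zu]]]] : ball x eps `&` principal_ideal u !=set0.
  by apply: du; [exists x; exact: ballxx|exact: ball_open].
exists (Num.bound c); rewrite -ball_normE /= in xz; apply: le_trans (ltW xz).
rewrite -[leRHS]norm_modulus; apply: norm_mono0 (vpos_ge0 _) _.
apply: vpos_lub (modulus_ge0 _).
have cu : c *: u <=v (Num.bound c)%:R *: u.
  by apply: vleZl u0; apply/ltW/Num.Theory.archi_boundP/ltW.
have h := modulusD (x - z) z; rewrite subrK in h.
have := vleD (vle_tr h (vleD (vle_refl _) (vle_tr zu cu)))
  (vle_refl (- ((Num.bound c)%:R *: u))).
by rewrite addrK.
Qed.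

(** If [v] is disjoint from [u], then it stays below the positive parts of
    [v - n u], and these become small. *)
Lemma full_ideal_disj u v : 0 <=v u -> full_ideal u -> 0 <=v v -> vdisj u v -> v = 0.
Proof.
move=> u0 full v0 uv; apply: vle_eq (v0); apply: vle0_norm => eps /(full v)[n hn].
apply: le_trans hn; apply: norm_mono0 (vpos_ge0 _) _.
rewrite (vpos_id v0) (modulus_id v0).
have h : n%:R *: u + v <=v vpos (v - n%:R *: u) + n%:R *: u.
  apply: vdisj_add_le; first exact: vdisjZ.
  - by apply: vle_lin (vpos_ge0 (v - n%:R *: u)) _; lin_module R E; ring.
  - by apply: vle_lin (vle_vpos (v - n%:R *: u)) _; lin_module R E; ring.
by apply: vle_lin h _; lin_module R E; ring.
Qed.

(** Truncations by the multiples of [u] are dense, so a closed subspace may be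
    tested on the order intervals below these multiples. *)
Lemma full_ideal_ind u (Y : E -> Prop) : 0 <=v u -> full_ideal u ->
  (forall (n : nat) x, 0 <=v x -> x <=v n%:R *: u -> Y x) ->
  (forall x y, Y x -> Y y -> Y (x - y)) ->
  (forall x, (forall eps : R, 0 < eps -> exists z, Y z /\ `|z - x| <= eps) -> Y x) ->
  forall x, Y x.
Proof.
move=> u0 full Yu YB Yc.
have Ypos x : 0 <=v x -> Y x.
  move=> x0; apply: (Yc) => eps /(full x)[n]; rewrite modulus_id// => hn.
  exists (vmeet x (n%:R *: u)); split; last first.
    by rewrite vmeetE addrAC subrr sub0r normrN.
  apply: (Yu n); last exact: vmeet_ler.
  by apply: vmeet_glb => //; exact: vscale_ge0.
by move=> x; rewrite -[x]vposBN; apply: YB; apply: Ypos; exact: vpos_ge0.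
Qed.

End QuasiInterior.

(** * Fixed vectors and invariant functionals of an irreducible operator *)

Section StrictlyPositiveFunctional.
Variables (R : realType) (E : banachLatticeType R).
Variables (phi : {scalar E}) (C : R).
Hypothesis phi_pos : forall x, 0 <=v x -> 0 <= phi x.
Hypothesis phi_bound : forall x, `|phi x| <= C * `|x|.
Hypothesis phi_strict : forall x, phi (modulus x) = 0 -> x = 0.
Implicit Types (x y z u v e : E).

Lemma phi_mono x y : x <=v y -> phi x <= phi y.
Proof. by move=> /vle_sub0/phi_pos; rewrite linearB /= subr_ge0. Qed.

Lemma phi_modulusD x y : phi (modulus (x + y)) <= phi (modulus x) + phi (modulus y).
Proof. by have := phi_mono (modulusD x y); rewrite linearD. Qed.

Lemma phi_modulusZ (a : R) x : phi (modulus (a *: x)) = `|a| * phi (modulus x).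
Proof. by rewrite modulusZ linearZ. Qed.

Lemma phi_modulus_ge0 x : 0 <= phi (modulus x).
Proof. exact/phi_pos/modulus_ge0. Qed.

Lemma phi_eq0 x : 0 <=v x -> phi x <= 0 -> x = 0.
Proof.
move=> x0 px; apply: phi_strict; rewrite modulus_id//.
by apply/eqP; rewrite eq_le px phi_pos.
Qed.

Lemma phi_gt0 x : 0 <=v x -> x != 0 -> 0 < phi x.
Proof.
by move=> x0; apply: contraNT; rewrite -leNgt => /(phi_eq0 x0)->.
Qed.

Lemma phi_inj x y : x <=v y -> phi x = phi y -> x = y.
Proof.
move=> /vle_sub0 xy e; apply/eqP; rewrite eq_sym -subr_eq0; apply/eqP.
by apply: phi_eq0 => //; rewrite linearB /= e subrr.
Qed.

Lemma phi_cvg (u : nat -> E) l : u @ \oo --> l -> (fun n => phi (u n)) @ \oo --> phi l.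
Proof. exact: (@bounded_cvg R E R phi C). Qed.

(** Otherwise the tail suprema of a sequence with summable [phi]-values would
    decrease in norm to a nonzero element on which [phi] vanishes. *)
Lemma small_on_interval e : order_continuous_norm E -> 0 <=v e ->
  forall eps : R, 0 < eps -> exists2 del : R, 0 < del &
  forall x, 0 <=v x -> x <=v e -> phi x <= del -> `|x| <= eps.
Proof.
move=> hE e0 eps eps0; apply: contrapT => hneg.
pose r (n : nat) : R := 2^-1 ^+ n.
have r0 n : 0 < r n by rewrite exprn_gt0// invr_gt0.
have rS n : r n = r n.+1 + r n.+1 by rewrite /r exprS; move: (_ ^+ n) => a; lra.
have /choice[x hx] n : exists x, [/\ 0 <=v x, x <=v e, phi x <= r n & eps < `|x|].
  apply: contrapT => h; apply: hneg; exists (r n) => // x x0 xe px.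
  by rewrite leNgt; apply/negP => xn; apply: h; exists x.
pose m := fix m j n := if n is k.+1 then vjoin (m j k) (x (j + k.+1)%N) else x j.
have m_e j n : m j n <=v e.
  by elim: n => [|n IH] /=; [have [] := hx j|apply: vjoin_lub => //;
    have [] := hx (j + n.+1)%N].
have m0 j n : 0 <=v m j n.
  elim: n => [|n IH] /=; first by have [] := hx j.
  exact: vle_tr IH (vle_joinl _ _).
have m_phi j n : phi (m j n) <= r j + r j - r (j + n)%N.
  elim: n => [|n IH] /=; first by rewrite addn0 addrK; have [] := hx j.
  have [x0 _ px _] := hx (j + n.+1)%N.
  have : vjoin (m j n) (x (j + n.+1)%N) <=v m j n + x (j + n.+1)%N.
    apply: vjoin_lub; first exact: vle_addr.
    by rewrite addrC; exact: vle_addr.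
  move=> /phi_mono; rewrite linearD /=; move: px IH; rewrite addnS (rS (j + n)%N).
  by move: (phi _) (phi _) (phi _) (r _) (r _) => *; lra.
have m_shift j n : m j.+1 n <=v m j n.+1.
  elim: n => [|n IH]; first by rewrite /= addn1; exact: vle_joinr.
  apply: vjoin_lub; first by apply: vle_tr IH _; exact: vle_joinl.
  by rewrite addSnnS; exact: vle_joinr.
have /choice[z hz] j : exists z, m j @ \oo --> z /\ forall n, m j n <=v z.
  have [n|n|z mz mle] := increasing_cvg hE (u := m j) (b := e).
  - exact: vle_joinl.
  - exact: m_e.
  by exists z.
have z_dec j : z j.+1 <=v z j.
  apply: vle_lim (hz j.+1).1 _ => n; apply: vle_tr (m_shift j n) _; exact: (hz j).2.
have z0 j : 0 <=v z j by apply: vge_lim (hz j).1 _ => n.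
have [w zw wz] := decreasing_cvg hE z_dec z0.
have zphi j : phi (z j) <= r j + r j.
  apply: (cvgr_to_le (phi_cvg (hz j).1)); exists 0%N => // n _ /=.
  by apply: le_trans (m_phi j n) _; rewrite gerBl ltW.
have pw : phi w <= 0.
  rewrite -[leRHS]addr0; have rc : r @ \oo --> (0 : R).
    by apply: cvg_expr; rewrite ger0_norm ?invr_ge0// invf_lt1// ltr1n.
  apply: (cvgr_to_ge (cvgD rc rc)); exists 0%N => // j _ /=.
  exact: le_trans (phi_mono (wz j)) (zphi j).
have w0 : 0 <=v w by exact: vge_lim zw z0.
move: zw; rewrite (phi_eq0 w0 pw) => /cvgrPdist_le/(_ _ eps0)[N _ /(_ N (leqnn _))] /=.
rewrite sub0r normrN => zN; have [xN0 _ _] := hx N; apply/negP; rewrite -leNgt.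
apply: le_trans zN; apply: norm_mono0 => //; exact: (hz N).2 0%N.
Qed.

End StrictlyPositiveFunctional.

Section Irreducible.
Variables (R : realType) (E : banachLatticeType R) (T : {linear E -> E}) (C : R).
Hypothesis C0 : 0 <= C.
Hypothesis Tpos : positive_op T.
Hypothesis TC : forall n x, `|iter n T x| <= C * `|x|.
Hypothesis Tirr : irreducible_op T.
Implicit Types (x y z u v w : E).

(** The closed ideal generated by a fixed vector is invariant. *)
Lemma fixed_full_ideal u : 0 <=v u -> u != 0 -> T u = u -> full_ideal u.
Proof.
move=> u0 un0 Tu.
have inv : T @` closed_ideal u `<=` closed_ideal u.
  move=> _ [x Jx <-] eps e0; have C1 : 0 < C + 1 by rewrite ltr_wpDl.
  have [n hn] := Jx _ (divr_gt0 e0 C1); exists n.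
  apply: (@le_trans _ _ `|T (vpos (modulus x - n%:R *: u))|); last first.
    apply: le_trans (TC 1 _) _; move: hn; rewrite ler_pdivlMr// => hn.
    by apply: le_trans hn; rewrite mulrC ler_wpM2l// lerDl.
  apply: norm_mono0 (vpos_ge0 _) _; apply: vle_tr (posop_vpos Tpos _).
  apply: vpos_mono; rewrite opB (opZ T) Tu.
  exact: vleD (posop_modulus Tpos x) (vle_refl _).
have [J0|JT] := Tirr (closed_idealP u0) (@closed_ideal_closed _ _ u) inv.
  have := closed_ideal_self u0; rewrite J0 => /= u00.
  by rewrite u00 eqxx in un0.
by move=> x; rewrite JT.
Qed.

(** The null ideal of an invariant positive functional is closed and
    invariant. *)
Lemma invariant_strictly_positive (phi : {scalar E}) (D : R) x0 :
  (forall x, 0 <=v x -> 0 <= phi x) -> (forall x, `|phi x| <= D * `|x|) ->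
  (forall x, phi (T x) = phi x) -> 0 < phi x0 ->
  forall x, phi (modulus x) = 0 -> x = 0.
Proof.
move=> pp pb pT px0; pose J := [set x | phi (modulus x) = 0].
have pmono := phi_mono pp; have pmod := phi_modulus_ge0 pp.
have Jle x (c : R) : J x <-> phi (modulus x) <= 0.
  by split=> [->//|h]; apply/eqP; rewrite eq_le h pmod.
have Jid : lattice_ideal J.
  split.
  - by rewrite /J /= modulus0 linear0.
  - move=> x y /= Jx Jy; apply/(Jle _ 0); apply: le_trans (phi_modulusD pp _ _) _.
    by rewrite Jx Jy addr0.
  - by move=> a x /= Jx; rewrite /J /= phi_modulusZ Jx mulr0.
  - by move=> x y /= Jy xy; apply/(Jle _ 0); rewrite -Jy; exact: pmono.
have Jcl : closed J.
  apply: norm_closed => x h; apply/(Jle _ 0)/ler_addgt0Pl => eps e0; rewrite addr0.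
  have D1 : 0 < `|D| + 1 by rewrite ltr_wpDl.
  have [z [Jz zx]] := h _ (divr_gt0 e0 D1).
  have := phi_modulusD pp (x - z) z; rewrite subrK (Jz : phi _ = 0) addr0.
  move/le_trans; apply; apply: le_trans (ler_norm _) _; apply: le_trans (pb _) _.
  rewrite norm_modulus distrC; move: zx; rewrite ler_pdivlMr// mulrC.
  apply: le_trans; apply: ler_wpM2r => //.
  by apply: le_trans (ler_norm _) _; rewrite lerDl.
have Jinv : T @` J `<=` J.
  move=> _ [x Jx <-]; apply/(Jle _ 0); rewrite -(Jx : phi _ = 0) -[leRHS]pT.
  exact/pmono/posop_modulus.
have [J0|JT] := Tirr Jid Jcl Jinv.
  by move=> x px; have : J x by []; rewrite J0.
have : J x0 by rewrite JT.
move=> /= Jx0; have := pmono _ _ (vle_modulus x0); rewrite Jx0.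
by rewrite leNgt px0.
Qed.

(** The modulus of a fixed vector is dominated by its image; a strictly positive
    invariant functional turns this into equality. *)
Lemma fixed_point_setup : Fix T <> [set 0] ->
  exists (phi : {scalar E}) (e : E),
    [/\ forall x, 0 <=v x -> 0 <= phi x, forall x, phi (T x) = phi x,
      forall x, `|phi x| <= C * `|x| & forall x, phi (modulus x) = 0 -> x = 0] /\
    [/\ 0 <=v e, e != 0 & T e = e].
Proof.
move=> fixT; have [x [xn0 Tx]] : exists x, x != 0 /\ T x = x.
  apply: contrapT => h; apply: fixT; apply/seteqP; split=> [x|_ ->] /=; last first.
    by rewrite /Fix /= linear0 subrr.
  move=> /eqP; rewrite subr_eq0 => /eqP xT; apply: contrapT => /eqP x0.
  by apply: h; exists x.
have e0 := modulus_ge0 x.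
have en0 : modulus x != 0 by rewrite -normr_eq0 norm_modulus normr_eq0.
have eT : modulus x <=v T (modulus x) by rewrite -{1}Tx; exact: posop_modulus.
have [phi [pp pT pb pe]] := invariant_functional Tpos TC e0 en0 eT.
have ps := invariant_strictly_positive pp pb pT pe.
exists phi, (modulus x); split; split=> //.
by apply/esym/(phi_inj pp ps eT); rewrite pT.
Qed.

End Irreducible.

(** * Positive parts of regular operators *)

Section ConeExtension.
Variables (R : realType) (E : banachLatticeType R) (V : lmodType R).
Implicit Types (x y z u : E).

(** The value at a difference [a - b] of positive elements has to be
    [s a - s b]; additivity makes it independent of the decomposition. *)
Lemma cone_extension (s : E -> V) :
  (forall x y, 0 <=v x -> 0 <=v y -> s (x + y) = s x + s y) ->
  (forall (a : R) x, 0 < a -> 0 <=v x -> s (a *: x) = a *: s x) ->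
  exists P : E -> V, linear P /\ forall x, 0 <=v x -> P x = s x.
Proof.
move=> sD sZ'.
have s0 : s 0 = 0.
  have := sD 0 0 (vle_refl _) (vle_refl _); rewrite addr0 => /eqP.
  by rewrite -subr_eq subrr => /eqP.
have sZ (a : R) x : 0 <= a -> 0 <=v x -> s (a *: x) = a *: s x.
  rewrite le_eqVlt => /orP[/eqP<- _|/sZ']; last exact.
  by rewrite !scale0r.
pose P x := s (vpos x) - s (vpos (- x)).
have PE x a b : 0 <=v a -> 0 <=v b -> x = a - b -> P x = s a - s b.
  move=> a0 b0 xab.
  have : s (vpos x + b) = s (vpos (- x) + a).
    have -> : b = a - x by rewrite xab; lin_module R E; ring.
    by congr s; rewrite vposN; lin_module R E; ring.
  rewrite !sD ?vpos_ge0// /P => /eqP; rewrite -subr_eq => /eqP e.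
  by rewrite -e; lin_module R V; ring.
exists P; split; last first.
  move=> x x0; rewrite (PE x x 0) ?subr0//; last exact: vle_refl.
  by rewrite s0 subr0.
move=> a x y; have [a0|/ltW] := leP 0 a; last rewrite -oppr_ge0 => a0.
  have ax z : 0 <=v a *: vpos z by apply: vscale_ge0 (vpos_ge0 _).
  rewrite (PE _ (a *: vpos x + vpos y) (a *: vpos (- x) + vpos (- y))).
  - by rewrite !sD ?sZ ?vpos_ge0// /P; lin_module R V; ring.
  - exact: vadd_ge0 (ax _) (vpos_ge0 _).
  - exact: vadd_ge0 (ax _) (vpos_ge0 _).
  - by rewrite -{1}(vposBN x) -{1}(vposBN y); lin_module R E; ring.
have ax z : 0 <=v (- a) *: vpos z by apply: vscale_ge0 (vpos_ge0 _).
rewrite (PE _ ((- a) *: vpos (- x) + vpos y) ((- a) *: vpos x + vpos (- y))).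
- by rewrite !sD ?sZ ?vpos_ge0// /P; lin_module R V; ring.
- exact: vadd_ge0 (ax _) (vpos_ge0 _).
- exact: vadd_ge0 (ax _) (vpos_ge0 _).
- by rewrite -{1}(vposBN x) -{1}(vposBN y); lin_module R E; ring.
Qed.

(** The Riesz-Kantorovich formula: by Riesz decomposition, the suprema of a
    linear map over the intervals [[0, x]] depend additively on [x]. *)
Lemma riesz_kantorovich (le : V -> V -> Prop) (D s : E -> V) :
  (forall a b, le a b -> le b a -> a = b) ->
  (forall a b c, le a b -> le (a + c) (b + c)) ->
  (forall (k : R) a b, 0 < k -> le a b -> le (k *: a) (k *: b)) ->
  (forall a b c, le a b -> le b c -> le a c) ->
  linear D ->
  (forall x u, 0 <=v u -> u <=v x -> le (D u) (s x)) ->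
  (forall x b, 0 <=v x -> (forall u, 0 <=v u -> u <=v x -> le (D u) b) -> le (s x) b) ->
  exists P : E -> V, linear P /\ forall x, 0 <=v x -> P x = s x.
Proof.
move=> anti leD leZ letr Dlin sub slub.
have DD x y : D (x + y) = D x + D y by have := Dlin 1 x y; rewrite !scale1r.
have D0 : D 0 = 0 by have := DD 0 0; rewrite addr0 => /eqP; rewrite -subr_eq subrr => /eqP.
have DZ a x : D (a *: x) = a *: D x by have := Dlin a x 0; rewrite D0 !addr0.
have add a b c d : le a b -> le c d -> le (a + c) (b + d).
  by move=> ab cd; apply: letr (leD _ _ c ab) _; rewrite ![b + _]addrC; exact: leD.
apply: cone_extension => [x y x0 y0|a x a0 x0].
  apply: anti.
    apply: slub => [|u u0 uxy]; first exact: vadd_ge0.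
    have [u1 [u2 [-> [u10 u1x] [u20 u2y]]]] := riesz_decomposition x0 y0 u0 uxy.
    by rewrite DD; apply: add; exact: sub.
  have h v : 0 <=v v -> v <=v y -> le (s x) (s (x + y) - D v).
    move=> v0 vy; apply: slub => // u u0 ux.
    have := leD _ _ (- D v) (sub (x + y) (u + v) (vadd_ge0 u0 v0) (vleD ux vy)).
    by rewrite DD addrK.
  have : le (s y) (s (x + y) - s x).
    apply: slub => // v v0 vy; have := leD _ _ (D v - s x) (h v v0 vy).
    by rewrite (_ : s x + _ = D v) 1?(_ : _ - _ + _ = s (x + y) - s x)//;
      lin_module R V; ring.
  by move=> /(leD _ _ (s x)); rewrite subrK addrC.
have le_aux b z : 0 < b -> 0 <=v z -> le (s (b *: z)) (b *: s z).
  move=> b0 z0; apply: slub => [|u u0 ubz]; first exact: vscale_ge0 (ltW b0) z0.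
  have bi : 0 < b^-1 by rewrite invr_gt0.
  have -> : D u = b *: D (b^-1 *: u) by rewrite DZ scalerA mulfV ?gt_eqF// scale1r.
  apply: leZ => //; apply: sub; first exact: vscale_ge0 (ltW bi) u0.
  by have := vleZ (ltW bi) ubz; rewrite scalerA mulVf ?gt_eqF// scale1r.
apply: anti; first exact: le_aux.
have ai : 0 < a^-1 by rewrite invr_gt0.
have := le_aux _ (a *: x) ai (vscale_ge0 _ _ (ltW a0) x0).
move=> /(leZ a _ _ a0); by rewrite !scalerA mulVf ?gt_eqF// mulfV ?gt_eqF// !scale1r.
Qed.

End ConeExtension.

Section PositivePart.
Variables (R : realType) (E : banachLatticeType R).
Hypothesis hE : order_continuous_norm E.
Implicit Types (x y z u : E) (A B D F G K L M N P Q S : {linear E -> E}).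

Definition mklin (V : lmodType R) (f : E -> V) (fl : linear f) : {linear E -> V} :=
  HB.pack f (GRing.isLinear.Build R E V *:%R f fl).

(** The last clause bounds the positive part by every upper bound of [D] on an
    order interval, linear or not, which is what the comparisons below need. *)
Lemma positive_part D :
  (forall x, 0 <=v x -> exists b, forall u, 0 <=v u -> u <=v x -> D u <=v b) ->
  exists P, [/\ positive_op P, op_le D P & forall x b, 0 <=v x ->
    (forall u, 0 <=v u -> u <=v x -> D u <=v b) -> P x <=v b].
Proof.
move=> Db.
have /choice[s hs] x : exists s, 0 <=v x ->
    vlub [set D u | u in [set u | 0 <=v u /\ u <=v x]] s.
  have [x0|nx0] := boolP (0 <=v x); last by exists 0.
  have [b hb] := Db _ x0.
  have [|_ [u [/= u0 ux] <-]|s hs] :=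
    @order_complete _ _ hE [set D u | u in [set u | 0 <=v u /\ u <=v x]] b.
  - by exists (D 0), 0 => //; split => //; exact: vle_refl.
  - exact: hb.
  by exists s.
have sub x u : 0 <=v u -> u <=v x -> D u <=v s x.
  by move=> u0 ux; have [h _] := hs x (vle_tr u0 ux); apply: h; exists u.
have slub x b : 0 <=v x -> (forall u, 0 <=v u -> u <=v x -> D u <=v b) -> s x <=v b.
  move=> x0 h; have [_] := hs x x0; apply => _ [u [u0 ux] <-]; exact: h.
have [P [Plin PE]] := @riesz_kantorovich R E E (fun a b => a <=v b) D s
  (@vle_eq _ _) (fun a b c ab => vle_add2r _ _ _ ab)
  (fun k a b k0 ab => vleZ (ltW k0) ab) (fun a b c => @vle_tr _ _ b a c)
  (@linearP _ _ _ _ D) sub slub.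
exists (mklin Plin); split=> [x x0|x x0|x b x0 h] /=; rewrite PE//.
- by have := sub x 0 (vle_refl _) x0; rewrite linear0.
- exact: sub (vle_refl _).
- exact: slub.
Qed.

(** If [P] is the positive part of [f], then [P + P - f] is its modulus. *)
Lemma positive_functional_bound (f : {scalar E}) : continuous (f : E -> R) ->
  exists g : {scalar E}, exists C : R, [/\ forall x, 0 <=v x -> 0 <= g x,
    forall x, 0 <=v x -> `|f x| <= g x & forall x, 0 <=v x -> g x <= C * `|x|].
Proof.
move=> fc.
have [C C0 fC] : exists2 C : R, 0 < C & forall x, `|f x| <= C * `|x|.
  have /linear_boundedP : bounded_near (f : E -> R^o) (nbhs (0 : E)).
    exact/linear_bounded_continuous.
  by move=> /pinfty_ex_gt0[C C0 h]; exists C.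
pose S x := [set f u | u in [set u | 0 <=v u /\ u <=v x]].
pose s x := sup (S x).
have fu x u : 0 <=v u -> u <=v x -> f u <= C * `|x|.
  move=> u0 ux; apply: le_trans (ler_norm _) _; apply: le_trans (fC u) _.
  by rewrite ler_pM2l//; exact: norm_mono0.
have S0 x : 0 <=v x -> S x !=set0.
  by move=> x0; exists (f 0), 0 => //; split=> //; exact: vle_refl.
have sub x u : 0 <=v u -> u <=v x -> f u <= s x.
  move=> u0 ux; apply: sup_upper_bound; last by exists u.
  split; first exact: S0 (vle_tr u0 ux).
  by exists (C * `|x|) => _ [v [v0 vx] <-]; exact: fu.
have slub x b : 0 <=v x -> (forall u, 0 <=v u -> u <=v x -> f u <= b) -> s x <= b.
  move=> x0 h; apply: ge_sup; first exact: S0.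
  by move=> _ [u [u0 ux] <-]; exact: h.
have flin : linear (f : E -> R^o) by move=> a x y; rewrite linearP.
have [P [Plin PE]] := @riesz_kantorovich R E R^o (fun a b => a <= b) f s
  (fun a b ab ba => le_anti (introT andP (conj ab ba)))
  (fun a b c ab => lerD ab (lexx c))
  (fun k a b k0 ab => ler_wpM2l (ltW k0) ab) (fun a b c ab bc => le_trans ab bc)
  flin sub slub.
have Pf x : 0 <=v x -> 0 <= P x /\ f x <= P x.
  move=> x0; rewrite PE//; split; last exact: sub x0 (vle_refl _).
  by have := sub x 0 (vle_refl _) x0; rewrite linear0.
have glin : linear_for *%R (fun x => P x + P x - f x).
  move=> a x y; rewrite linearP Plin /=.
  by rewrite -[a *: P x]/(a * P x); ring.
pose g : {scalar E} := HB.pack (fun x => P x + P x - f x)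
  (GRing.isLinear.Build R E R *%R (fun x => P x + P x - f x) glin).
exists g, (C + C + C); split=> x x0; have [h1 h2] := Pf _ x0.
- by rewrite /g /=; lra.
- by rewrite /g /= ler_norml; apply/andP; split; lra.
have := fC x; rewrite ler_norml => /andP[h3 _].
have : P x <= C * `|x| by rewrite PE//; apply: slub => // u u0 ux; exact: fu.
by rewrite /g /= !mulrDl; move: h3; move: (C * `|x|) (P x) (f x) => *; lra.
Qed.

(** With positive functionals [g_i] that dominate [f_i], the sum of the
    [g_i(x) |y_i|] is at most the product of the two sums of [g_i(x)] and of
    [|y_i|]: domination by rank one suffices for every finite rank. *)
Lemma finite_rank_dominated (F : E -> E) : finite_rank F ->
  linear F /\ exists (g : {scalar E}) (y : E) (C : R),
  [/\ forall x, 0 <=v x -> 0 <= g x, forall x, 0 <=v x -> g x <= C * `|x|, 0 <=v y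
    & forall x, 0 <=v x -> modulus (F x) <=v g x *: y].
Proof.
move=> [m [f [y [fc FE]]]]; split.
  move=> a u v; rewrite !FE scaler_sumr -big_split /=; apply: eq_bigr => i _.
  by rewrite linearP scalerDl scalerA.
have /choice[g hg] i := positive_functional_bound (fc i).
have {hg}/choice[D hg] := hg.
have slin : linear_for *%R (fun x => \sum_(i < m) g i x).
  by move=> a u v; rewrite mulr_sumr -big_split /=; apply: eq_bigr => i _; rewrite linearP.
pose s : {scalar E} := HB.pack (fun x => \sum_(i < m) g i x)
  (GRing.isLinear.Build R E R *%R (fun x => \sum_(i < m) g i x) slin).
exists s, (\sum_(i < m) modulus (y i)), (\sum_(i < m) D i); split.
- by move=> x x0; apply: sumr_ge0 => i _; have [h _ _] := hg i; exact: h.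
- by move=> x x0; rewrite mulr_suml; apply: ler_sum => i _; have [_ _ h] := hg i; exact: h.
- by apply: vsum_ge0 => i _; exact: modulus_ge0.
move=> x x0; rewrite FE.
apply: (@vle_tr _ _ (\sum_(i < m) modulus (f i x *: y i))).
  elim/big_ind2: _ => [|x1 x2 y1 y2 h1 h2|i _]; last exact: vle_refl.
    by rewrite modulus0; exact: vle_refl.
  exact: vle_tr (modulusD _ _) (vleD h1 h2).
rewrite scaler_sumr; apply: vle_sum => i _; rewrite modulusZ.
apply: vleZl (modulus_ge0 _); have [h0 h _] := hg i; apply: le_trans (h x x0) _.
rewrite /s /= (bigD1 i)//= lerDl; apply: sumr_ge0 => j _.
by have [h' _ _] := hg j; exact: h'.
Qed.

(** The modulus of a finite rank operator [F] is [2 F^+ - F]. If it is not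
    disjoint from [T], some regular [Q] below both is not negative, and its
    positive part serves as [K]. *)
Lemma harris_minorant (T : {linear E -> E}) : positive_op T ->
  ~ disjoint_complement (@finite_rank R E) T ->
  exists K (g : {scalar E}) (y : E) (C : R),
  [/\ positive_op K, op_le K T & exists2 x, 0 <=v x & K x != 0] /\
  [/\ forall x, 0 <=v x -> 0 <= g x, forall x, 0 <=v x -> g x <= C * `|x|, 0 <=v y
    & forall x, 0 <=v x -> K x <=v g x *: y].
Proof.
move=> Tp ndisj; apply: contrapT => hneg; apply: ndisj.
have zlin : linear ((fun=> 0) : E -> E) by move=> a x y; rewrite scaler0 addr0.
have pos_regular A : positive_op A -> regular A.
  move=> Ap; exists A, (mklin zlin); split=> //= x; last by rewrite subr0.
  by move=> _; exact: vle_refl.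
split; first exact: pos_regular.
move=> F Ffin; have [Flin [g [y [C [g0 gC y0 Fgy]]]]] := finite_rank_dominated Ffin.
have gylin : linear (fun x => g x *: y) by move=> a u v; rewrite linearP scalerDl scalerA.
pose G := mklin gylin.
have Gpos : positive_op G by move=> x x0; apply: vscale_ge0; [exact: g0|].
have [|P [Ppos FP Plub]] := @positive_part (mklin Flin).
  move=> x x0; exists (G x) => u u0 ux; apply: vle_tr (posop_mono Gpos ux).
  exact: vle_tr (vle_modulus _) (Fgy _ u0).
have Mlin : linear (fun x => P x + P x - F x).
  by move=> a u v; rewrite linearP Flin; lin_module R E; ring.
pose M := mklin Mlin.
have Mpos : positive_op M.
  by move=> x x0; apply: vle_lin (vleD (FP x x0) (Ppos x x0)) _ => /=;
    lin_module R E; ring.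
have Mlub : op_modulus F M.
  split; first exact: pos_regular.
  - move=> S [->|->] x x0.
      by apply: vle_lin (vleD (FP x x0) (FP x x0)) _ => /=; lin_module R E; ring.
    by apply: vle_lin (vleD (Ppos x x0) (Ppos x x0)) _ => /=; lin_module R E; ring.
  move=> N [A [B [Apos Bpos NE]]] hN x x0 /=.
  suff h : P x <=v 2^-1 *: (N x + F x).
    by apply: vle_lin (vleD h h) _; lin_module R E; field.
  apply: Plub => // u u0 ux /=.
  have xu0 := vle_sub0 ux.
  have h1 := hN _ (or_intror erefl) _ xu0.
  have h2 := hN _ (or_introl erefl) _ u0.
  have Nxu : N (x - u) = N x - N u.
    by rewrite !NE (opB A) (opB B); lin_module R E; ring.
  have Fxu : F (x - u) = F x - F u by rewrite -[F]/(mklin Flin : E -> E) opB.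
  have half : 0 <= 2^-1 :> R by rewrite invr_ge0.
  have := vleZ half (vleD h1 h2); rewrite /= Nxu Fxu => h.
  by apply: vle_lin h _; lin_module R E; field.
have MG x : 0 <=v x -> M x <=v G x.
  move=> x0; have [_ _ least] := Mlub; apply: least (x0); first exact: pos_regular.
  move=> S [->|->] z z0; apply: vle_tr (Fgy z z0).
    exact: vle_modulus.
  exact: vleN_modulus.
exists M, T; split=> //.
  split; first exact: pos_regular.
  - move=> S [->|->] x x0; first exact: vle_refl.
    have Tx := Tp x x0.
    by apply: vle_lin (vadd_ge0 Tx Tx) _; lin_module R E; ring.
  - by move=> N _; apply; left.
split.
- by apply: (pos_regular (mklin zlin)) => x _; exact: vle_refl.
- by move=> S [->|->]; [exact: Mpos|exact: Tp].
move=> Q [A [B [Apos Bpos QE]]] hQ x x0.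
have QM := hQ _ (or_introl erefl); have QT := hQ _ (or_intror erefl).
have Qlin : linear Q by move=> a u v; rewrite !QE (linearP A) (linearP B); lin_module R E; ring.
have [|K [Kpos QK Klub]] := @positive_part (mklin Qlin).
  by move=> z z0; exists (M z) => u u0 uz; exact: vle_tr (QM u u0) (posop_mono Mpos uz).
have [Kx0|Kx0] := eqVneq (K x) 0; first by rewrite -Kx0; exact: QK.
exfalso; apply: hneg; exists K, g, y, C; split; split=> //.
- move=> z z0; apply: Klub => // u u0 uz.
  exact: vle_tr (QT u u0) (posop_mono Tp uz).
- by exists x.
- move=> z z0; apply: Klub => // u u0 uz.
  apply: vle_tr (QM u u0) _; apply: vle_tr (MG u u0) _; exact: (posop_mono Gpos uz).
Qed.

(** Disjointness of positive operators in the lattice of regular operators. *)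
Definition odisj A B := forall L, positive_op L -> op_le L A -> op_le L B ->
  forall x, 0 <=v x -> L x = 0.

(** Disjointness makes [A] the positive part of [A - S], and [G - S] is a
    positive upper bound of [A - S]. *)
Lemma odisj_add_le A S G : positive_op A -> positive_op S -> odisj A S ->
  op_le A G -> op_le S G -> forall x, 0 <=v x -> A x + S x <=v G x.
Proof.
move=> Apos Spos AS AG SG x x0.
have Dlin : linear (fun x => A x - S x).
  by move=> a u v; rewrite (linearP A) (linearP S); lin_module R E; ring.
have DA u : 0 <=v u -> A u - S u <=v A u by move=> /Spos/vle_subr.
have [|P [Ppos DP Plub]] := @positive_part (mklin Dlin).
  move=> z z0; exists (A z) => u u0 uz /=.
  exact: vle_tr (DA u u0) (posop_mono Apos uz).
have Llin : linear (fun x => A x - P x).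
  by move=> a u v; rewrite (linearP A) (linearP P); lin_module R E; ring.
have L0 : A x - P x = 0.
  apply: (AS (mklin Llin)) => // z z0 /=.
  - apply: vle_sub0; apply: Plub => // u u0 uz.
    exact: vle_tr (DA u u0) (posop_mono Apos uz).
  - exact: vle_subr (Ppos z z0).
  - by apply: vle_lin (DP z z0) _ => /=; lin_module R E; ring.
have h : P x <=v G x - S x.
  apply: Plub => // u u0 ux /=.
  have h1 := SG _ (vle_sub0 ux); rewrite !opB in h1.
  by apply: vle_lin (vleD h1 (AG u u0)) _; lin_module R E; ring.
move: L0 => /eqP; rewrite subr_eq0 => /eqP ->.
by apply: vle_lin h _; lin_module R E; ring.
Qed.

(** A lower bound [L] of [S + A] and [B] satisfies [(L - S)^+ <= A], so that
    disjointness from [A] pushes [L] below [S]. *)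
Lemma odisjD A B S Q : positive_op A -> positive_op S ->
  (forall x, Q x = S x + A x) -> odisj S B -> odisj A B -> odisj Q B.
Proof.
move=> Apos Spos QE SB AB L Lpos LQ LB x x0.
have Dlin : linear (fun x => L x - S x).
  by move=> a u v; rewrite (linearP L) (linearP S); lin_module R E; ring.
have DL u : 0 <=v u -> L u - S u <=v L u by move=> /Spos/vle_subr.
have [|P [Ppos DP Plub]] := @positive_part (mklin Dlin).
  move=> z z0; exists (L z) => u u0 uz.
  exact: vle_tr (DL u u0) (posop_mono Lpos uz).
have P0 z : 0 <=v z -> P z = 0.
  apply: AB => // v v0; apply: Plub => // u u0 uv.
    apply: vle_tr (posop_mono Apos uv) => /=.
    by have := LQ u u0; rewrite QE => h; apply: vle_lin h _; lin_module R E; ring.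
  exact: vle_tr (DL u u0) (vle_tr (posop_mono Lpos uv) (LB v v0)).
apply: SB x0 => // z z0.
by have := DP z z0; rewrite P0//= => h; apply: vle_lin h _; lin_module R E; ring.
Qed.

Lemma odisj_sum_le (A : nat -> {linear E -> E}) G :
  (forall i, positive_op (A i)) -> (forall i, op_le (A i) G) ->
  (forall i j, (i < j)%N -> odisj (A i) (A j)) -> positive_op G ->
  forall (n : nat) x, 0 <=v x -> \sum_(i < n) A i x <=v G x.
Proof.
move=> Apos AG Adis Gpos m.
have Slin n : linear (fun x => \sum_(i < n) A i x).
  move=> a u v; rewrite scaler_sumr -big_split /=.
  by apply: eq_bigr => i _; rewrite linearP.
pose S n := mklin (Slin n).
have Spos n : positive_op (S n) by move=> x x0; apply: vsum_ge0 => i _; exact: Apos.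
have SS n x : S n.+1 x = S n x + A n x by rewrite /S /= big_ord_recr.
have Sdis n j : (n <= j)%N -> odisj (S n) (A j).
  elim: n => [_ L Lpos LS _ x x0|n IH nj].
    by apply: vle_eq (Lpos x x0); have := LS x x0; rewrite /= big_ord0.
  exact: odisjD (SS n) (IH (ltnW nj)) (Adis _ _ nj).
suff h n : op_le (S n) G by exact: (h m).
elim: n => [|n IH] x x0; first by rewrite /= big_ord0; exact: Gpos.
by rewrite SS; exact: odisj_add_le (Sdis n n (leqnn n)) _ _ _ x0.
Qed.

End PositivePart.

(** * Overlapping powers *)

Section Overlap.
Variables (R : realType) (E : banachLatticeType R) (T : {linear E -> E}) (C : R).
Hypothesis hE : order_continuous_norm E.
Hypothesis C0 : 0 <= C.
Hypothesis Tpos : positive_op T.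
Hypothesis TC : forall n x, `|iter n T x| <= C * `|x|.
Hypothesis Tirr : irreducible_op T.
Variables (phi : {scalar E}) (e : E).
Hypothesis phi_pos : forall x, 0 <=v x -> 0 <= phi x.
Hypothesis phi_inv : forall x, phi (T x) = phi x.
Hypothesis phi_strict : forall x, phi (modulus x) = 0 -> x = 0.
Hypothesis e0 : 0 <=v e.
Hypothesis en0 : e != 0.
Hypothesis Te : T e = e.
Implicit Types (x y z u v w : E) (K L : {linear E -> E}).

(** A lower bound of the positive part of [x] and of [y], diminished by the
    negative part of [x], is a lower bound of [x] and [y]. *)
Lemma vdisj_vpos x y : vdisj x y -> vdisj (vpos x) y.
Proof.
move=> xy z zx zy; apply: (@vdisj_pos_neg _ _ x) => //.
suff h : z - vpos (- x) <=v 0 by apply: vle_lin h _; lin_module R E; ring.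
apply: xy; last exact: vle_tr (vle_subr _ (vpos_ge0 _)) zy.
by apply: vle_lin zx _; rewrite vposN; lin_module R E; ring.
Qed.

Lemma phi_psum n x : phi (psum T n x) = n%:R * phi x.
Proof.
have phi_iter k : phi (iter k T x) = phi x.
  by elim: k => //= k IH; rewrite phi_inv.
elim: n => [|n IH]; first by rewrite /psum big_ord0 linear0 mul0r.
by rewrite psumS linearD /= IH phi_iter -addn1 natrD mulrDl mul1r.
Qed.

(** The truncated sums increase to a fixed vector [p]. If [p] were not [e], then
    the fixed vector [e - p] would be quasi-interior and disjoint from the part
    of the sums above [p], so that the sums would be bounded. *)
Lemma recurrence w (t : R) : 0 <=v w -> w != 0 -> 0 < t ->
  (fun n => vmeet (t *: psum T n w) e) @ \oo --> e.
Proof.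
move=> w0 wn0 t0; pose a n := vmeet (t *: psum T n w) e.
have ps0 n : 0 <=v psum T n w by exact: psum_pos.
have ame n : a n <=v e by exact: vmeet_ler.
have amono n : a n <=v a n.+1.
  apply: vmeet_glb (ame n); apply: vle_tr (vmeet_lel _ _) _.
  by apply: vleZ (ltW t0) _; rewrite psumS; apply: vle_addr; exact: iter_pos.
have [p ap pa] := increasing_cvg hE amono ame.
have pe : p <=v e by exact: vle_lim ap ame.
have p0 : 0 <=v p.
  by apply: vle_tr (pa 0%N); apply: vmeet_glb => //; exact: vscale_ge0 (ltW t0) (ps0 _).
have Ta n : T (a n) <=v p.
  apply: vle_tr (pa n.+1); apply: vmeet_glb; last first.
    by rewrite -[X in _ <=v X]Te; exact: posop_mono.
  apply: vle_tr (posop_mono Tpos (vmeet_lel _ _)) _; rewrite opZ.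
  apply: vleZ (ltW t0) _; rewrite psumSl addrC; exact: vle_addr.
have Tp : T p = p.
  have Tpp : T p <=v p := vle_lim (bounded_cvg (TC 1) ap) Ta.
  by apply: (phi_inj phi_pos phi_strict Tpp); rewrite phi_inv.
suff {2}-> : e = p by [].
apply/eqP; apply: contraT => pne.
have q0 := vle_sub0 pe.
have qfull : full_ideal (e - p).
  by apply: (fixed_full_ideal C0 Tpos TC Tirr) => //; rewrite ?subr_eq0// opB Te Tp.
have bnd n : t *: psum T n w <=v p.
  have disj : vdisj (vpos (t *: psum T n w - p)) (e - p).
    apply: vdisj_vpos => z z1 z2.
    have h : z + p <=v p.
      apply: vle_tr (pa n); apply: vmeet_glb.
        by apply: vle_lin z1 _; lin_module R E; ring.
      by apply: vle_lin z2 _; lin_module R E; ring.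
    by apply: vle_lin h _; lin_module R E; ring.
  have := full_ideal_disj q0 qfull (vpos_ge0 _) (vdisj_sym disj) => v0.
  have := vle_vpos (t *: psum T n w - p); rewrite v0 => h.
  by apply: vle_lin h _; lin_module R E; ring.
have tw : 0 < t * phi w by rewrite mulr_gt0//; exact: phi_gt0.
have := Num.Theory.archi_boundP (divr_ge0 (phi_pos p0) (ltW tw)).
set n := Num.bound _; rewrite ltr_pdivrMr// => h.
have := phi_mono phi_pos (bnd n); rewrite linearZ /= phi_psum.
by move: h; rewrite mulrCA => h /(lt_le_trans h); rewrite ltxx.
Qed.

Lemma minorant_bound L m : positive_op L -> op_le L (iter m T) ->
  forall x, `|L x| <= C * `|x|.
Proof.
move=> Lpos LT x; rewrite -[leRHS](congr1 _ (norm_modulus x)).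
apply: le_trans (TC m (modulus x)); apply: norm_mono.
exact: vle_tr (posop_modulus Lpos x) (LT _ (modulus_ge0 x)).
Qed.

Lemma minorant_eq0 L m : positive_op L -> op_le L (iter m T) -> L e = 0 ->
  forall x, L x = 0.
Proof.
move=> Lpos LT Le; have efull := fixed_full_ideal C0 Tpos TC Tirr e0 en0 Te.
apply: (full_ideal_ind e0 efull) => [n x x0 xe|x y Lx Ly|x h].
- apply: vle_eq (Lpos x x0); have := posop_mono Lpos xe.
  by rewrite opZ Le scaler0.
- by rewrite opB Lx Ly subrr.
apply/eqP; rewrite -normr_le0; apply/ler_addgt0Pl => eps eps0; rewrite addr0.
have C1 : 0 < C + 1 by rewrite ltr_wpDl.
have [z [Lz zx]] := h _ (divr_gt0 eps0 C1).
have -> : L x = - L (z - x) by rewrite opB Lz sub0r opprK.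
rewrite normrN; apply: le_trans (minorant_bound Lpos LT _) _.
move: zx; rewrite ler_pdivlMr// mulrC; apply: le_trans.
by apply: ler_wpM2r => //; rewrite lerDl.
Qed.

(** The operators [K T^i K] all lie below one operator of rank one. If they were
    pairwise disjoint, their sum would too, contradicting recurrence. *)
Lemma overlapping_powers : harris T -> exists m d L,
  [/\ (0 < d)%N, positive_op L, op_le L (iter m T), op_le L (iter (d + m) T)
    & L e != 0].
Proof.
move=> [_ [n [_ ndisj]]].
have [K [g [y [G [[Kpos KT [x1 x10 Kx1]] [g0 gG y0 Kgy]]]]]] :=
  @harris_minorant _ _ hE (iter n T) (iter_pos n Tpos) ndisj.
have Ken0 : K e != 0.
  by apply: contraNneq Kx1 => /(minorant_eq0 Kpos KT) ->.
have Alin i : linear (fun x => K (iter i T (K x))).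
  by move=> a u v; rewrite !linearP.
pose A i := mklin (Alin i).
have Apos i : positive_op (A i) by move=> x x0; exact/Kpos/iter_pos/Kpos.
have AT i : op_le (A i) (iter (n + (i + n)) T).
  move=> x x0; rewrite !iterD /A /=.
  apply: vle_tr (KT _ (iter_pos i Tpos (Kpos _ x0))) _.
  apply: (posop_mono (A := iter n T)); first exact: iter_pos.
  apply: (posop_mono (A := iter i T)); first exact: iter_pos.
  exact: KT.
apply: contrapT => hneg.
have Adis i j : (i < j)%N -> odisj (A i) (A j).
  move=> ij L Lpos Li Lj x x0; apply: contrapT => Lx.
  apply: hneg; exists (n + (i + n))%N, (j - i)%N, L; split=> //.
  - by rewrite subn_gt0.
  - by move=> z z0; exact: vle_tr (Li z z0) (AT i z z0).
  - move=> z z0; apply: vle_tr (Lj z z0) _.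
    rewrite (_ : (j - i + (n + (i + n)))%N = (n + (j + n))%N); first exact: AT.
    by rewrite addnCA [((j - i) + (_ + _))%N]addnA subnK// ltnW.
  - apply/eqP => Le; apply: Lx; apply: (minorant_eq0 (m := (n + (i + n))%N) Lpos _ Le).
    by move=> z z0; exact: vle_tr (Li z z0) (AT i z z0).
pose c : R := `|G| * (C * `|y|).
have c0 : 0 <= c by rewrite mulr_ge0// mulr_ge0.
have Blin : linear (fun x => g x *: (c *: y)).
  by move=> a u v; rewrite linearP scalerDl !scalerA !mulrA.
have Bpos : positive_op (mklin Blin).
  by move=> x x0; apply: vscale_ge0; [exact: g0|exact: vscale_ge0].
have AB i : op_le (A i) (mklin Blin).
  move=> x x0 /=; have Ty0 := iter_pos i Tpos y0.
  apply: (@vle_tr _ _ (K (iter i T (g x *: y)))).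
    apply: (posop_mono Kpos); apply: (posop_mono (A := iter i T)).
      exact: iter_pos.
    exact: Kgy.
  rewrite linearZ /= opZ; apply: vleZ (g0 x x0) _; apply: vle_tr (Kgy _ Ty0) _.
  apply: vleZl y0; apply: le_trans (gG _ Ty0) _.
  apply: le_trans (ler_wpM2r (normr_ge0 _) (ler_norm G)) _.
  by apply: ler_wpM2l.
pose w := K e; have w0 : 0 <=v w by exact: Kpos.
have bnd N : K (psum T N w) <=v mklin Blin e.
  have := odisj_sum_le hE Apos AB Adis Bpos N e0.
  by rewrite /psum linear_sum.
have Kle (t : R) : 0 < t -> K e <=v t *: mklin Blin e.
  move=> t0; apply: vle_lim (bounded_cvg (minorant_bound Kpos KT) (recurrence w0 Ken0 t0)) _.
  move=> N /=; apply: vle_tr (posop_mono Kpos (vmeet_lel _ _)) _.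
  by rewrite opZ; apply: vleZ (ltW t0) (bnd N).
have Ke0 : K e <=v 0.
  apply: (archimedean (x := mklin Blin e)) => N.
  have [->|N0] := posnP N; first by rewrite scale0r; exact: Bpos.
  have N0' : 0 < N%:R :> R by rewrite ltr0n.
  have Ni : 0 < N%:R^-1 :> R by rewrite invr_gt0.
  have := vleZ (ltW N0') (Kle _ Ni).
  by rewrite scalerA mulfV ?gt_eqF// scale1r.
by move/eqP: Ken0; apply; exact: vle_eq Ke0 w0.
Qed.

End Overlap.

(** * Binomial averages *)

Lemma central_bin_recur n :
  (n.+1 * 'C(n.+1.*2, n.+1) = 2 * n.*2.+1 * 'C(n.*2, n))%N.
Proof.
have h1 := mul_bin_diag n.*2.+2 n; have h2 := mul_bin_down n.*2.+1 n.
have e : (n.*2.+1 - n)%N = n.+1 by rewrite -addnn -addnS addKn.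
rewrite e /= in h2; rewrite /= in h1.
apply/eqP; rewrite -(eqn_pmul2l (ltn0Sn n)) doubleS -h1 mulnCA -h2.
by rewrite -doubleS -mul2n; apply/eqP; ring.
Qed.

Lemma central_bin_bound n : (n.*2.+1 * 'C(n.*2, n) ^ 2 <= 16 ^ n)%N.
Proof.
elim: n => [|n IH]; first by rewrite bin0.
have n1 : (0 < n.+1 ^ 2)%N by [].
rewrite -(leq_pmul2l n1) mulnCA -expnMn central_bin_recur.
apply: (@leq_trans (4 * (n.*2.+3 * n.*2.+1) * (n.*2.+1 * 'C(n.*2, n) ^ 2))%N).
  by apply: eq_leq; rewrite doubleS; ring.
apply: (@leq_trans (4 * (n.*2.+3 * n.*2.+1) * 16 ^ n)%N).
  by rewrite leq_mul2l IH orbT.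
rewrite (expnS 16) [X in (_ <= X)%N]mulnA leq_mul2r; apply/orP; right.
by rewrite -addnn; nia.
Qed.

Lemma bin_increasing n i : (i < n)%N -> ('C(n.*2, i) <= 'C(n.*2, i.+1))%N.
Proof.
move=> lt; have h := mul_bin_left n.*2 i; rewrite -(leq_pmul2l (ltn0Sn i)) h.
by apply: leq_mul => //; rewrite -addnn; lia.
Qed.

Lemma bin_decreasing n i : (n <= i)%N -> ('C(n.*2, i.+1) <= 'C(n.*2, i))%N.
Proof.
move=> lt; have h := mul_bin_left n.*2 i; rewrite -(leq_pmul2l (ltn0Sn i)) h.
by apply: leq_mul => //; rewrite -addnn; lia.
Qed.

Section UnimodalVariation.
Variables (R : realDomainType) (c : nat -> R) (n : nat).
Hypothesis c0 : 0 <= c 0%N.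
Hypothesis c_incr : forall i, (i < n)%N -> c i <= c i.+1.
Hypothesis c_decr : forall i, (n <= i)%N -> c i.+1 <= c i.

Definition increment i := c i - (if i is j.+1 then c j else 0).

(** The total variation of a unimodal sequence telescopes on both sides of its
    maximum. *)
Lemma variation_unimodal j :
  \sum_(i < (n + j).+1) `|increment i| = c n + c n - c (n + j)%N.
Proof.
elim: j => [|j IH].
  rewrite addn0 addrK; have : (n <= n)%N by [].
  elim: {-2}n => [_|k IH kn].
    by rewrite big_ord_recr big_ord0 /= add0r /increment subr0 ger0_norm.
  rewrite big_ord_recr /= (IH (ltnW kn)) /increment ger0_norm ?subr_ge0 ?c_incr//.
  by rewrite addrC subrK.
rewrite addnS big_ord_recr /= IH /increment ler0_norm ?subr_le0 ?c_decr ?leq_addr//.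
ring.
Qed.

End UnimodalVariation.

Section BinomialAverages.
Variables (R : realType) (E : banachLatticeType R) (V : {linear E -> E}).
Hypothesis Vpos : positive_op V.
Variable phi : {scalar E}.
Hypothesis phi_pos : forall x, 0 <=v x -> 0 <= phi x.
Hypothesis phi_inv : forall x, phi (V x) = phi x.
Implicit Types (x y z u v w : E).

Lemma average_linear : linear (fun x => 2^-1 *: (x + V x) : E).
Proof. by move=> a u v; rewrite (linearP V); lin_module R E; ring. Qed.

Definition average : {linear E -> E} := mklin average_linear.

Lemma averageE x : average x = 2^-1 *: (x + V x). Proof. by []. Qed.

Lemma average_pos : positive_op average.
Proof.
move=> x x0; rewrite averageE; apply: vscale_ge0; first by rewrite invr_ge0.
exact: vadd_ge0 x0 (Vpos x0).
Qed.

Lemma phi_average x : phi (average x) = phi x.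
Proof. by rewrite averageE linearZ linearD /= phi_inv; field. Qed.

Lemma average_binomial l N w : (l < N)%N ->
  (2 ^+ l : R) *: iter l average w = \sum_(i < N) 'C(l, i)%:R *: iter i V w.
Proof.
elim: l N w => [|l IH] [//|N] w lN.
  rewrite expr0 scale1r big_ord_recl /= bin0 scale1r big1 ?addr0// => i _.
  by rewrite bin0n scale0r.
have -> : (2 ^+ l.+1 : R) *: iter l.+1 average w =
    \sum_(i < N.+1) 'C(l, i)%:R *: iter i V w
    + V (\sum_(i < N) 'C(l, i)%:R *: iter i V w).
  rewrite -(IH N.+1 w (ltnW lN)) -(IH N w lN) iterS averageE (opZ V) exprSr.
  by lin_module R E; field.
rewrite linear_sum /=.
rewrite !big_ord_recl /= !bin0 -addrA; congr (_ + _); rewrite -big_split /=.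
apply: eq_bigr => i _; rewrite (opZ V) /bump /= binS natrD scalerDl.
by congr (_ + _).
Qed.

(** The differences of consecutive binomial averages are small: their
    coefficients are the increments of the unimodal sequence of the binomial
    coefficients, whose total variation is twice the central one. *)
Lemma average_variation n w : 0 <=v w ->
  phi (modulus (iter n.*2 average w - V (iter n.*2 average w))) <=
  2 * ('C(n.*2, n)%:R / 4 ^+ n) * phi w.
Proof.
move=> w0; pose c i : R := 'C(n.*2, i)%:R.
set S := iter _ _ _.
have two : (2 ^+ n.*2 : R) = 4 ^+ n.
  by rewrite -mul2n exprM; congr (_ ^+ n); ring.
have SE : (4 ^+ n : R) *: (S - V S) = \sum_(i < n.*2.+2) increment c i *: iter i V w.
  rewrite scalerBr -(opZ V) -two {1}(average_binomial w (ltnW (ltnSn n.*2.+1))).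
  rewrite (average_binomial w (ltnSn n.*2)) linear_sum /=.
  rewrite big_ord_recl [RHS]big_ord_recl /= /increment subr0 -addrA; congr (_ + _).
  rewrite -sumrB; apply: eq_bigr => i _.
  by rewrite (opZ V) /= scalerBl.
have phi_iter i : phi (iter i V w) = phi w.
  by elim: i => //= i IH; rewrite phi_inv.
have four : 0 < (4 ^+ n : R) by rewrite exprn_gt0.
suff h : 4 ^+ n * phi (modulus (S - V S)) <= 2 * c n * phi w.
  rewrite -(ler_pM2l four); apply: le_trans h _.
  rewrite le_eqVlt; apply/orP; left; apply/eqP; field.
  by rewrite gt_eqF.
have -> : 4 ^+ n * phi (modulus (S - V S)) = phi (modulus (4 ^+ n *: (S - V S))).
  by rewrite modulusZ linearZ /= gtr0_norm.
rewrite SE.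
apply: (@le_trans _ _ (\sum_(i < n.*2.+2) `|increment c i| * phi w)).
  apply: (@le_trans _ _ (\sum_(i < n.*2.+2) phi (modulus (increment c i *: iter i V w)))).
    elim/big_ind2: _ => [|x1 x2 y1 y2 h1 h2|//]; first by rewrite modulus0 linear0.
    exact: le_trans (phi_modulusD phi_pos _ _) (lerD h1 h2).
  apply: ler_sum => i _; rewrite modulusZ linearZ /=.
  by rewrite modulus_id ?phi_iter//; exact: iter_pos.
rewrite -mulr_suml; apply: ler_wpM2r; first exact: phi_pos.
have -> : n.*2.+2 = (n + n.+1).+1 by rewrite addnS addnn.
rewrite variation_unimodal.
- rewrite {3}/c bin_small ?subr0; last by rewrite addnS addnn.
  by rewrite -mulr2n mulr_natl.
- by rewrite /c ler0n.
- by move=> i ilt; rewrite /c ler_nat bin_increasing.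
- by move=> i ilt; rewrite /c ler_nat bin_decreasing.
Qed.

Lemma average_variation_small (a : R) : 0 < a -> exists l, forall w, 0 <=v w ->
  phi (modulus (iter l average w - V (iter l average w))) <= a * phi w.
Proof.
(* The central coefficient is at most [4^n / sqrt (2 n + 1)]. *)
move=> a0; pose n := Num.bound (4 / a ^+ 2); exists n.*2 => w w0.
apply: le_trans (average_variation n w0) _.
apply: ler_wpM2r; first exact: phi_pos.
have a2 : 0 < a ^+ 2 by rewrite exprn_gt0.
have /ltW := Num.Theory.archi_boundP (divr_ge0 (ler0n R 4) (ltW a2)).
rewrite -/n ler_pdivrMr// => hn.
have q0 : 0 <= 2 * ('C(n.*2, n)%:R / 4 ^+ n) :> R.
  by rewrite mulr_ge0// divr_ge0// exprn_ge0.
rewrite -ler_sqr ?nnegrE ?(ltW a0)//.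
pose K : R := 'C(n.*2, n)%:R; pose x : R := 4 ^+ n.
have x0 : 0 < x by rewrite exprn_gt0.
rewrite -/K -/x; have -> : (2 * (K / x)) ^+ 2 = 4 * K ^+ 2 / x ^+ 2.
  by field; rewrite gt_eqF.
rewrite ler_pdivrMr ?exprn_gt0//.
have h : (n + n + 1)%:R * K ^+ 2 <= x ^+ 2.
  rewrite /K /x -exprM mulnC exprM -[4]/(4%:R) -!natrX -natrM ler_nat.
  by rewrite addnn addn1; exact: central_bin_bound.
have K2 : 0 <= K ^+ 2 by rewrite exprn_ge0// /K ler0n.
apply: le_trans (ler_wpM2r K2 hn) _; rewrite mulrAC mulrC ler_pM2l//.
apply: le_trans h; apply: ler_wpM2r => //; rewrite ler_nat; lia.
Qed.

End BinomialAverages.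

(** * The zero-two law *)

Section ZeroTwo.
Variables (R : realType) (E : banachLatticeType R) (T : {linear E -> E}) (C : R).
Hypothesis hE : order_continuous_norm E.
Hypothesis C0 : 0 <= C.
Hypothesis Tpos : positive_op T.
Hypothesis TC : forall n x, `|iter n T x| <= C * `|x|.
Hypothesis Tirr : irreducible_op T.
Variables (phi : {scalar E}) (D : R) (e : E).
Hypothesis phi_pos : forall x, 0 <=v x -> 0 <= phi x.
Hypothesis phi_inv : forall x, phi (T x) = phi x.
Hypothesis phi_bound : forall x, `|phi x| <= D * `|x|.
Hypothesis phi_strict : forall x, phi (modulus x) = 0 -> x = 0.
Hypothesis e0 : 0 <=v e.
Hypothesis Te : T e = e.
Variables (m d : nat) (L : {linear E -> E}).
Hypothesis d0 : (0 < d)%N.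
Hypothesis Lpos : positive_op L.
Hypothesis Lm : op_le L (iter m T).
Hypothesis Ldm : op_le L (iter (d + m) T).
Hypothesis Le : L e != 0.
Implicit Types (x y z u v w : E).

Let V : {linear E -> E} := iter d T.
Let U : {linear E -> E} := iter (d + m) T.
Let B : {linear E -> E} := average V.

Lemma phi_iter n x : phi (iter n T x) = phi x.
Proof. by elim: n => //= n IH; rewrite phi_inv. Qed.

Lemma phi_contract (A : {linear E -> E}) x : positive_op A ->
  (forall y, phi (A y) = phi y) -> phi (modulus (A x)) <= phi (modulus x).
Proof.
by move=> Apos Ainv; rewrite -[leRHS]Ainv; exact/(phi_mono phi_pos)/posop_modulus.
Qed.

Let Vpos : positive_op V. Proof. exact: iter_pos. Qed.
Let Upos : positive_op U. Proof. exact: iter_pos. Qed.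
Let Bpos : positive_op B. Proof. exact: average_pos. Qed.

Lemma iter_iter_comm i j x : iter i T (iter j T x) = iter j T (iter i T x).
Proof. by rewrite -!iterD addnC. Qed.

Lemma iter_average_comm i x : iter i T (B x) = B (iter i T x).
Proof. by rewrite /B !averageE (opZ (iter i T)) (opD (iter i T)) /V /= iter_iter_comm. Qed.

Lemma iter_iter_average_comm i l x : iter i T (iter l B x) = iter l B (iter i T x).
Proof. by elim: l => //= l IH; rewrite iter_average_comm IH. Qed.

(** What remains of [T^(d+m)] after removing the part that factors through the
    average of the identity and [T^d]. *)
Lemma residual_linear : linear (fun x => U x - B (L x)).
Proof. by move=> a u v; rewrite (linearP U) (linearP L) (linearP B); lin_module R E; ring. Qed.

Let Q : {linear E -> E} := mklin residual_linear.

Let QE x : Q x = U x - B (L x). Proof. by []. Qed.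

Lemma residual_pos : positive_op Q.
Proof.
move=> x x0; rewrite QE /B averageE.
have h1 := Ldm x0; have h2 := posop_mono Vpos (Lm x0).
rewrite /V /= -iterD in h2.
have half : 0 <= 2^-1 :> R by rewrite invr_ge0.
have := vleZ half (vleD h1 h2) => h.
by apply: vle_lin h _; rewrite /U /V /=; lin_module R E; field.
Qed.

Lemma residual_le x : 0 <=v x -> Q x <=v U x.
Proof. by move=> x0; rewrite QE; exact/vle_subr/Bpos/Lpos. Qed.

(** [U w] and [L] applied to the remainder feed the average at each step, as [U]
    commutes with the average. *)
Lemma residual_split k z : 0 <=v z -> exists w, [/\ 0 <=v w, phi w <= phi z,
  w <=v 2%:R *: iter k U z & iter k U z = B w + iter k Q z].
Proof.
move=> z0.
have Qk0 j : 0 <=v iter j Q z by exact: (iter_pos j residual_pos).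
have phiU j x : phi (iter j U x) = phi x.
  by elim: j => //= j IH; rewrite /U phi_iter IH.
have phiB x : phi (B x) = phi x by rewrite phi_average// => y; rewrite /V phi_iter.
suff [w [w0 wk]] : exists w, 0 <=v w /\ iter k U z = B w + iter k Q z.
  exists w; split=> //.
    have := phiU k z; rewrite wk linearD /= phiB => <-.
    by rewrite lerDl; exact: phi_pos.
  have h := vadd_ge0 (Vpos w0) (vadd_ge0 (Qk0 k) (Qk0 k)).
  by apply: vle_lin h _; rewrite wk /B averageE; lin_module R E; field.
elim: k => [|k [w [w0 IH]]].
  by exists 0; split; [exact: vle_refl|rewrite linear0 add0r].
exists (U w + L (iter k Q z)); split; first exact: vadd_ge0 (Upos w0) (Lpos (Qk0 k)).
have UB x : U (B x) = B (U x) by exact: iter_average_comm.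
by rewrite !iterS IH (opD U) UB QE (opD B); lin_module R E; ring.
Qed.

(** The residual powers of [e] decrease to a fixed vector of [T^(d+m)] that [L]
    annihilates. The complement [g] of this vector is therefore nonzero, and on
    its ideal the residual powers vanish. *)
Lemma residual_vanishes : exists g, [/\ 0 <=v g, g <=v e, g != 0,
  U g = g & (fun k => iter k Q g) @ \oo --> (0 : E)].
Proof.
have Ue : U e = e by rewrite /U /=; elim: (d + m)%N => //= n ->.
have Qe0 k : 0 <=v iter k Q e by exact: (iter_pos k residual_pos).
have Qe : Q e <=v e by rewrite -[X in _ <=v X]Ue; exact: residual_le.
have Qdec k : iter k.+1 Q e <=v iter k Q e.
  by elim: k => // k IH; exact: (posop_mono residual_pos IH).
have [h Qh hQ] := decreasing_cvg hE Qdec Qe0.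
have h0 : 0 <=v h by exact: vge_lim Qh Qe0.
have he : h <=v e by exact: hQ 0%N.
have QC x : `|Q x| <= C * `|x|.
  rewrite -[leRHS](congr1 _ (norm_modulus x)).
  apply: le_trans (TC (d + m) (modulus x)); apply: norm_mono.
  exact: vle_tr (posop_modulus residual_pos x) (residual_le (modulus_ge0 x)).
have Qhh : Q h = h.
  have : (fun k => iter k.+1 Q e) @ \oo --> h by have := Qh; rewrite -cvg_shiftS.
  by apply: cvg_unique; first exact: norm_hausdorff; exact: (bounded_cvg QC Qh).
have Uh : U h = h.
  apply: esym; apply: (phi_inj phi_pos phi_strict); last by rewrite /U phi_iter.
  by rewrite -{1}Qhh; exact: residual_le.
have Lh : L h = 0.
  apply: (phi_eq0 phi_pos phi_strict (Lpos h0)).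
  have BL : B (L h) = 0.
    by apply: (addrI (- h)); rewrite addr0 -{3}Qhh QE Uh; lin_module R E; ring.
  by rewrite -(@phi_average _ _ V phi _ (L h)) 1?[X in phi X]BL ?linear0// => y;
    rewrite /V phi_iter.
exists (e - h); split.
- exact: vle_sub0.
- exact: vle_subr.
- by rewrite subr_eq0; apply: contraNneq Le => ->; rewrite Lh.
- by rewrite opB Ue Uh.
have Qkh k : iter k Q h = h by elim: k => //= k ->.
rewrite (_ : (fun k => _) = fun k => iter k Q e - h).
  rewrite -[X in _ --> X](subrr h); apply: cvgB Qh _; exact: cvg_cst.
by apply/funext => k; rewrite (opB (iter k Q)) /= Qkh.
Qed.

(** Iterating the splitting piles up powers of the average, since the powers of
    [T] commute with it. *)
Lemma average_approx g : 0 <=v g -> U g = g -> (fun k => iter k Q g) @ \oo --> (0 : E) ->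
  forall (l : nat) z (eps : R), 0 <=v z -> z <=v g -> 0 < eps ->
  exists k w, [/\ 0 <=v w, w <=v (2 ^+ l) *: g, phi w <= phi z
    & phi (modulus (iter k U z - iter l B w)) <= eps].
Proof.
move=> g0 Ug Qg l z eps z0 zg; elim: l eps => [|l IH] eps eps0.
  exists 0%N, z; split=> //; first by rewrite expr0 scale1r.
  by rewrite /= subrr modulus0 linear0 ltW.
have e2 : 0 < eps / 2 by rewrite divr_gt0.
have phiB x : phi (B x) = phi x by rewrite phi_average// => y; rewrite /V phi_iter.
have phiBl x : phi (iter l.+1 B x) = phi x.
  by elim: l.+1 => //= n IHn; rewrite phiB.
have phiU j x : phi (iter j U x) = phi x.
  by elim: j => //= j IHj; rewrite /U phi_iter IHj.
have Ujg j : iter j U g = g by elim: j => //= j ->.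
have UB j x : iter j U (iter l B x) = iter l B (iter j U x).
  by elim: j => //= j ->; exact: iter_iter_average_comm.
have [k [w [w0 wg wz kw]]] := IH _ e2.
have two : 0 < 2 ^+ l :> R by rewrite exprn_gt0.
have := phi_cvg phi_bound Qg; rewrite linear0.
move=> /cvgrPdist_le/(_ _ (divr_gt0 e2 two))[j _ /(_ j (leqnn _))].
rewrite /= sub0r normrN ler_pdivlMr// => hj.
have Qw0 : 0 <=v iter j Q w by exact: (iter_pos j residual_pos).
have Qw : phi (iter j Q w) <= eps / 2.
  apply: le_trans (phi_mono phi_pos (posop_mono (iter_pos j residual_pos) wg)) _.
  rewrite /= (opZ (iter j Q)) linearZ /= mulrC; apply: le_trans hj.
  by rewrite ler_pM2r// ler_norm.
have [w' [w'0 w'w w'U wE]] := residual_split j w0.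
exists (j + k)%N, w'; split=> //.
- apply: vle_tr w'U _; rewrite exprS -scalerA.
  apply: vleZ => //; rewrite -(Ujg j) -(opZ (iter j U)).
  exact: (posop_mono (iter_pos j Upos) wg).
- exact: le_trans w'w wz.
have -> : iter (j + k) U z - iter l.+1 B w' =
    iter j U (iter k U z - iter l B w) + iter l B (iter j Q w).
  rewrite (opB (iter j U)) /= UB wE (opD (iter l B)) /= iterD -iterSr iterS.
  by lin_module R E; ring.
apply: le_trans (phi_modulusD phi_pos _ _) _; rewrite [eps]splitr; apply: lerD.
  apply: le_trans kw; apply: phi_contract; first exact: (iter_pos j Upos).
  exact: phiU.
rewrite modulus_id; last exact: (iter_pos l Bpos).
by have -> : phi (iter l B (iter j Q w)) = phi (iter j Q w)
  by elim: (l) => //= n IHn; rewrite phiB.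
Qed.

(** Measured by [phi] instead of the norm, the defect of periodicity decreases
    along the orbit. *)
Definition asymp_periodic x := forall eps : R, 0 < eps -> exists k0, forall k,
  (k0 <= k)%N -> phi (modulus (iter k T (x - V x))) <= eps.

Lemma asymp_periodic_intro x :
  (forall eps : R, 0 < eps -> exists k, phi (modulus (iter k T (x - V x))) <= eps) ->
  asymp_periodic x.
Proof.
move=> h eps /h[k hk]; exists k => j kj; apply: le_trans hk.
rewrite -(subnK kj) iterD; apply: phi_contract; first exact: iter_pos.
exact: phi_iter.
Qed.

Lemma asymp_periodicD x y : asymp_periodic x -> asymp_periodic y -> asymp_periodic (x + y).
Proof.
move=> hx hy; apply: asymp_periodic_intro => eps eps0.
have e2 : 0 < eps / 2 by rewrite divr_gt0.
have [[k hk] [j hj]] := (hx _ e2, hy _ e2); exists (maxn k j).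
have -> : x + y - V (x + y) = (x - V x) + (y - V y).
  by rewrite (opD V); lin_module R E; ring.
rewrite (opD (iter (maxn k j) T)) /= [eps]splitr.
apply: le_trans (phi_modulusD phi_pos _ _) _; apply: lerD.
  exact/hk/leq_maxl.
exact/hj/leq_maxr.
Qed.

Lemma asymp_periodic_iter n x : asymp_periodic (iter n T x) -> asymp_periodic x.
Proof.
move=> h; apply: asymp_periodic_intro => eps /h[k /(_ k (leqnn _))] hk.
exists (k + n)%N; move: hk; rewrite iterD.
by rewrite {1}/V /= iter_iter_comm -(opB (iter n T)).
Qed.

(** The remainder of the approximation by [B^l w] is small in [phi]; the main
    term is almost periodic by the estimate of the binomial averages. *)
Lemma asymp_periodic_below g : 0 <=v g -> U g = g ->
  (fun k => iter k Q g) @ \oo --> (0 : E) ->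
  forall z, 0 <=v z -> z <=v g -> asymp_periodic z.
Proof.
move=> g0 Ug Qg z z0 zg; apply: asymp_periodic_intro => eps eps0.
have phiV x : phi (V x) = phi x by rewrite /V phi_iter.
have pz1 : 0 < 2 * (phi z + 1) by rewrite mulr_gt0// ltr_wpDl// phi_pos.
have a0 : 0 < eps / (2 * (phi z + 1)) by rewrite divr_gt0.
have [l hl] := average_variation_small Vpos phi_pos phiV a0.
have e4 : 0 < eps / 4 by rewrite divr_gt0.
have [k [w [w0 _ wz kw]]] := average_approx g0 Ug Qg l z0 zg e4.
exists (k * (d + m))%N.
have Uk x : iter (k * (d + m)) T x = iter k U x.
  by elim: (k) x => // n IH x; rewrite mulSn iterD IH.
rewrite (opB (iter (k * (d + m)) T)) /= iter_iter_comm !Uk.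
have -> : iter k U z - iter d T (iter k U z) =
  (iter k U z - iter l B w) + (- V (iter k U z - iter l B w)
    + (iter l B w - V (iter l B w))).
  by rewrite (opB V) /V; lin_module R E; ring.
apply: le_trans (phi_modulusD phi_pos _ _) _.
have h1 := phi_modulusD phi_pos (- V (iter k U z - iter l B w))
  (iter l B w - V (iter l B w)).
have h2 : phi (modulus (- V (iter k U z - iter l B w))) <= eps / 4.
  by rewrite modulusN; apply: le_trans kw; exact: phi_contract.
have h3 : eps / (2 * (phi z + 1)) * phi w <= eps / 2.
  rewrite mulrAC ler_pdivrMr//.
  have : eps * phi w <= eps * (phi z + 1) by rewrite ler_pM2l//; lra.
  by lra.
have h4 := hl w w0.
apply: le_trans (lerD kw h1) _; apply: le_trans (lerD (lexx _) (lerD h2 h4)) _.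
by move: h3; set p := _ * phi w; lra.
Qed.

(** The sum of the first [d + m] iterates of [g] is a fixed vector of [T], hence
    quasi-interior, and the vectors below it decompose along the iterates. *)
Lemma zero_two x (eps : R) : 0 < eps ->
  exists k0, forall k, (k0 <= k)%N -> `|iter k T (x - iter d T x)| <= eps.
Proof.
have [g [g0 ge gn0 Ug Qg]] := residual_vanishes.
set M := (d + m)%N; pose q := psum T M g.
have Tq : T q = q.
  have := psumSl T M g; rewrite psumS [iter M T g]Ug addrC => /addrI.
  exact: esym.
have gq : g <=v q.
  rewrite /q /M; case: (d) d0 => // d' _; rewrite addSn psumSl.
  by apply: vle_addr; apply: Tpos; exact: psum_pos.
have q0 : 0 <=v q by exact: vle_tr g0 gq.
have qn0 : q != 0.
  by apply: contraNneq gn0 => q00; apply/eqP/vle_eq => //; rewrite -q00.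
have qfull := fixed_full_ideal C0 Tpos TC Tirr q0 qn0 Tq.
have per_iter i z : (i <= M)%N -> 0 <=v z -> z <=v iter i T g -> asymp_periodic z.
  (* The remaining [M - i] steps of the cycle bring [z] below [g]. *)
  move=> iM z0 zg; apply: (@asymp_periodic_iter (M - i)).
  apply: (asymp_periodic_below g0 Ug Qg); first exact: iter_pos.
  rewrite -Ug /U /= -/M -{2}(subnK iM) iterD.
  exact: (posop_mono (iter_pos (M - i) Tpos) zg).
have per0 : asymp_periodic 0.
  move=> eps' e'; exists 0%N => k _.
  by rewrite linear0 subr0 linear0 modulus0 linear0 ltW.
have per_sum n : (n <= M)%N -> forall z, 0 <=v z -> z <=v psum T n g -> asymp_periodic z.
  elim: n => [_ z z0|n IH nM z z0].
    by rewrite /psum big_ord0 => zle; rewrite (vle_eq zle z0).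
  rewrite psumS => zle.
  have [z1 [z2 [-> [z10 z1g] [z20 z2g]]]] :=
    riesz_decomposition (psum_pos Tpos n g0) (iter_pos n Tpos g0) z0 zle.
  apply: asymp_periodicD; first exact: IH (ltnW nM) _ z10 z1g.
  exact: per_iter (ltnW nM) z20 z2g.
have per_q n z : 0 <=v z -> z <=v n%:R *: q -> asymp_periodic z.
  elim: n z => [|n IH] z z0.
    by rewrite scale0r => zle; rewrite (vle_eq zle z0).
  rewrite -addn1 natrD scalerDl scale1r => zle.
  have [z1 [z2 [-> [z10 z1q] [z20 z2q]]]] :=
    riesz_decomposition (vscale_ge0 _ _ (ler0n R n) q0) q0 z0 zle.
  apply: asymp_periodicD; first exact: IH.
  exact: per_sum (leqnn M) _ z20 z2q.
pose Y x := forall eps : R, 0 < eps ->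
  exists k0, forall k, (k0 <= k)%N -> `|iter k T (x - V x)| <= eps.
suff : forall x, Y x by move=> h; exact: h.
apply: (full_ideal_ind q0 qfull) => {eps x} [n z z0 zq eps eps0|x y Yx Yy eps eps0|x h eps eps0].
- have nq : 0 <=v n%:R *: q by exact: vscale_ge0.
  have [del del0 hdel] := small_on_interval phi_pos phi_bound phi_strict hE
    (vadd_ge0 nq nq) eps0.
  have [k0 hk0] := per_q n z z0 zq _ del0.
  exists k0 => k kk; rewrite -norm_modulus; apply: hdel (modulus_ge0 _) _ (hk0 k kk).
  have Tnq j : iter j T (n%:R *: q) = n%:R *: q.
    by elim: j => //= j ->; rewrite opZ Tq.
  have Vz : V z <=v n%:R *: q.
    by rewrite -(Tnq d); exact: (posop_mono Vpos zq).
  have V0 := Vpos z0.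
  apply: vle_tr (posop_modulus (iter_pos k Tpos) _) _.
  rewrite -{1}(Tnq k) -{2}(Tnq k) -(opD (iter k T)).
  apply: (posop_mono (iter_pos k Tpos)); apply: modulus_lub.
    apply: vle_tr (vle_subr _ V0) _; exact: vle_tr zq (vle_addr _ nq).
  rewrite opprB; apply: vle_tr (vle_subr _ z0) _; exact: vle_tr Vz (vle_addr _ nq).
- have e2 : 0 < eps / 2 by rewrite divr_gt0.
  have [[k hk] [j hj]] := (Yx _ e2, Yy _ e2); exists (maxn k j) => i.
  rewrite geq_max => /andP[/hk ki /hj ji].
  have -> : x - y - V (x - y) = (x - V x) - (y - V y).
    by rewrite (opB V); lin_module R E; ring.
  rewrite (opB (iter i T)) /= [eps]splitr.
  by apply: le_trans (ler_normB _ _) _; exact: lerD.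
pose K := C * (1 + C).
have K0 : 0 <= K by rewrite mulr_ge0// addr_ge0.
have K1 : 0 < 2 * (K + 1) by rewrite mulr_gt0// ltr_wpDl.
have e2 : 0 < eps / 2 by rewrite divr_gt0.
have [z [Yz zx]] := h _ (divr_gt0 eps0 K1).
have [k0 hk0] := Yz _ e2; exists k0 => k kk.
have -> : x - V x = (z - V z) - ((z - x) - V (z - x)).
  by rewrite (opB V); lin_module R E; ring.
rewrite (opB (iter k T)) /= [eps]splitr; apply: le_trans (ler_normB _ _) _.
apply: lerD; first exact: hk0.
apply: le_trans (TC _ _) _.
apply: (@le_trans _ _ (K * `|z - x|)).
  rewrite /K -mulrA; apply: ler_wpM2l => //; apply: le_trans (ler_normB _ _) _.
  by rewrite mulrDl mul1r; apply: lerD => //; exact: TC.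
apply: le_trans (ler_wpM2l K0 zx) _.
rewrite mulrA ler_pdivrMr//.
have : eps * K <= eps * (K + 1) by rewrite ler_pM2l// lerDl.
by lra.
Qed.

End ZeroTwo.

(** * Mean ergodicity and convergence *)

Section MeanErgodic.
Variables (R : realType) (E : banachLatticeType R) (S : {linear E -> E}) (C : R).
Hypothesis hE : order_continuous_norm E.
Hypothesis C0 : 0 <= C.
Hypothesis Spos : positive_op S.
Hypothesis SC : forall n x, `|iter n S x| <= C * `|x|.
Variables (phi : {scalar E}) (D : R) (e : E).
Hypothesis phi_pos : forall x, 0 <=v x -> 0 <= phi x.
Hypothesis phi_inv : forall x, phi (S x) = phi x.
Hypothesis phi_bound : forall x, `|phi x| <= D * `|x|.
Hypothesis phi_strict : forall x, phi (modulus x) = 0 -> x = 0.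
Hypothesis e0 : 0 <=v e.
Hypothesis Se : S e = e.
Hypothesis efull : full_ideal e.
Implicit Types (x y z u v w p q s b : E).

Lemma cesaro_fixed n p : S p = p -> cesaro S n.+1 p = p.
Proof.
move=> Sp; rewrite /cesaro /psum (eq_bigr (fun=> p)); last first.
  by move=> i _; elim: (nat_of_ord i) => //= k ->.
by rewrite sumr_const card_ord -(scaler_nat _ p) scalerA mulVf ?scale1r// pnatr_eq0.
Qed.

Lemma cesaroBS n x :
  cesaro S n.+1 x - S (cesaro S n.+1 x) = n.+1%:R^-1 *: (x - iter n.+1 S x).
Proof.
rewrite -psum_id_sub /cesaro (opZ S) -scalerBr; congr (_ *: _).
have -> : S (psum S n.+1 x) = psum S n.+1 (S x).
  by rewrite /psum linear_sum; apply: eq_bigr => i _ /=; rewrite -iterS iterSr.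
by rewrite (opB (psum S n.+1)).
Qed.

(** The maximal ergodic inequality. The sequence [N] dominates the partial sums
    of [x - p + a e], and telescoping bounds [phi (x - p + a e)] from below by the
    negative parts of [N]. The limit [q] of these negative parts is disjoint from
    the positive part of every mean; were [q] not disjoint from [e], the bound [s]
    on the means of [x] could be lowered. *)
Lemma maximal_ergodic x p s : S p = p -> p <=v s ->
  (forall n, cesaro S n.+1 x <=v s) ->
  (forall b, (forall n, cesaro S n.+1 x <=v b) -> s <=v b) ->
  phi p <= phi x.
Proof.
move=> Sp ps sub slub.
suff main (a : R) : 0 < a -> 0 <= phi x - phi p + a * phi e.
  have pe1 : 0 < phi e + 1 by rewrite ltr_wpDl// phi_pos.
  apply/ler_addgt0Pl => eps eps0.
  have := main _ (divr_gt0 eps0 pe1).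
  have : eps / (phi e + 1) * phi e <= eps.
    by rewrite mulrAC ler_pdivrMr// ler_pM2l// lerDl.
  by set r := _ * phi e; lra.
move=> a0; pose y := x - p + a *: e.
pose N := fix N n := if n is k.+1 then y + S (vpos (N k)) else y.
have Nmono n : N n <=v N n.+1.
  elim: n => [|n IH]; first exact/vle_addr/Spos/vpos_ge0.
  exact: vleD (vle_refl _) (posop_mono Spos (vpos_mono IH)).
have psN n : psum S n.+1 y <=v N n.
  elim: n => [|n IH]; first by rewrite /psum big_ord1; exact: vle_refl.
  rewrite psumSl; apply: vleD (vle_refl _) (posop_mono Spos _).
  exact: vle_tr IH (vle_vpos _).
have phiN n : - phi y <= phi (vpos (- N n)).
  have := phi_mono phi_pos (Nmono n).
  have -> : phi (N n.+1) = phi y + phi (vpos (N n)) by rewrite linearD /= phi_inv.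
  by rewrite vposN linearB /=; lra.
have [n|n|q Nq qN] := decreasing_cvg hE (u := fun n => vpos (- N n)) (b := 0).
- exact/vpos_mono/vleN.
- exact: vpos_ge0.
have q0 : 0 <=v q by apply: vge_lim Nq _ => n; exact: vpos_ge0.
have phiq : - phi y <= phi q.
  by apply: (cvgr_to_ge (phi_cvg phi_bound Nq)); exists 0%N.
have ae0 : 0 <=v a *: e by exact: vscale_ge0 (ltW a0) e0.
pose w := vmeet q (a *: e).
have w0 : 0 <=v w by exact: vmeet_glb.
have cy n : cesaro S n.+1 y = cesaro S n.+1 x - p + a *: e.
  rewrite (opD (cesaro S n.+1)) (opB (cesaro S n.+1)) (opZ (cesaro S n.+1)) /=.
  by rewrite (cesaro_fixed n Sp) (cesaro_fixed n Se).
have disj n : vdisj (vpos (cesaro S n.+1 y)) w.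
  rewrite /cesaro vposZ ?invr_ge0//; apply: vdisjZ (vpos_ge0 _) w0 _.
  apply: (vdisj_mono (vle_refl _) _ (@vdisj_pos_neg _ _ (psum S n.+1 y))).
  apply: vle_tr (vmeet_lel _ _) (vle_tr (qN n) _).
  exact: (vpos_mono (vleN (psN n))).
have sw : s <=v s - w.
  apply: slub => n.
  have h : vpos (cesaro S n.+1 y) + w <=v s - p + a *: e.
    apply: vdisj_add_le (disj n) _ _.
      apply: vpos_lub; last exact: vadd_ge0 (vle_sub0 ps) ae0.
      rewrite cy; apply: vleD (vle_refl _).
      exact: vleD (sub n) (vle_refl _).
    apply: vle_tr (vmeet_ler _ _) _; rewrite addrC.
    exact/vle_addr/vle_sub0.
  have := vle_tr (vleD (vle_vpos (cesaro S n.+1 y)) (vle_refl w)) h.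
  by rewrite cy => h'; apply: vle_lin h' _; lin_module R E; ring.
have wle : w <=v 0 by apply: vle_lin sw _; lin_module R E; ring.
have eq : vdisj e q.
  rewrite -[e](scalerK (lt0r_neq0 a0)) /=; apply: vdisjZ ae0 q0 _.
  by move=> z z1 z2; apply: vle_tr wle; exact: vmeet_glb.
have qz : q = 0 by exact: full_ideal_disj e0 efull q0 eq.
move: phiq; rewrite qz linear0 /y linearD linearB linearZ /=; lra.
Qed.

(** The tail suprema of the means decrease to [l]. Since [S] moves the means only
    by multiples of [b / n], passing to suprema gives [l <= S l], and [phi] turns
    this into equality. *)
Lemma cesaro_limsup x b : 0 <=v x -> x <=v b -> S b = b ->
  exists (s : nat -> E) (l : E), [/\ s @ \oo --> l, S l = l, phi l <= phi x,
    forall n, l <=v s n & forall n, cesaro S n.+1 x <=v s n].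
Proof.
move=> x0 xb Sb; have b0 := vle_tr x0 xb.
have cb n : cesaro S n.+1 x <=v b.
  by rewrite -(cesaro_fixed n Sb); exact: (posop_mono (cesaro_pos Spos n.+1) xb).
have c0 n : 0 <=v cesaro S n x by exact: cesaro_pos.
have /choice[s hs] j : exists s, vlub [set cesaro S k.+1 x | k in [set k | (j <= k)%N]] s.
  apply: (order_complete hE (b0 := b)); first by exists (cesaro S j.+1 x), j => //=.
  by move=> _ [k _ <-].
have sub j k : (j <= k)%N -> cesaro S k.+1 x <=v s j.
  by move=> jk; have [h _] := hs j; apply: h; exists k.
have slub j c : (forall k, (j <= k)%N -> cesaro S k.+1 x <=v c) -> s j <=v c.
  by move=> h; have [_] := hs j; apply => _ [k jk <-]; exact: h.
have sdec j : s j.+1 <=v s j by apply: slub => k jk; apply: sub; exact: ltnW.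
have s0 j : 0 <=v s j by apply: vle_tr (sub j j (leqnn j)).
have [l sl ls] := decreasing_cvg hE sdec s0.
have Sn n : iter n S b = b by elim: n => //= n ->.
have step j : s j <=v S (s j) + j.+1%:R^-1 *: b.
  apply: slub => k jk; rewrite -[cesaro S k.+1 x](subrK (S (cesaro S k.+1 x))).
  rewrite cesaroBS addrC; apply: vleD; first exact: (posop_mono Spos (sub _ _ jk)).
  apply: (@vle_tr _ _ (k.+1%:R^-1 *: b)).
    apply: vleZ; first by rewrite invr_ge0.
    exact: vle_tr (vle_subr _ (iter_pos k.+1 Spos x0)) xb.
  by apply: vleZl b0; rewrite lef_pV2 ?posrE// ler_nat.
have lSl : l <=v S l.
  have h : (fun j => S (s j) + j.+1%:R^-1 *: b) @ \oo --> S l + 0 *: b.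
    apply: cvgD; first exact: (bounded_cvg (SC 1) sl).
    by apply: cvgZr_tmp; exact: cvg_harmonic.
  rewrite scale0r addr0 in h; apply: vge_lim h _ => j.
  exact: vle_tr (ls j) (step j).
have Sl : S l = l by apply/esym/(phi_inj phi_pos phi_strict lSl); rewrite phi_inv.
exists s, l; split=> //.
  apply: (maximal_ergodic Sl (ls 0%N)) => [n|c h]; first exact: sub.
  by apply: slub => k _; exact: h.
by move=> n; exact: sub.
Qed.

(** The upper limits [l] of the means of [x] and [l'] of the means of [b - x]
    satisfy [b <= l + l'], while the maximal inequality gives the reverse in
    [phi]-value; so [l] is also the lower limit of the means of [x]. *)
Lemma mean_ergodic x b : 0 <=v x -> x <=v b -> S b = b ->
  exists2 l, S l = l & forall eps : R, 0 < eps ->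
    exists n, `|cesaro S n.+1 x - l| <= eps.
Proof.
move=> x0 xb Sb; have b0 := vle_tr x0 xb.
have [s [l [sl Sl phil ls cs]]] := cesaro_limsup x0 xb Sb.
have [s' [l' [sl' Sl' phil' ls' cs']]] :=
  cesaro_limsup (vle_sub0 xb) (vle_subr b x0) Sb.
have cx' n : cesaro S n.+1 (b - x) = b - cesaro S n.+1 x.
  by rewrite (opB (cesaro S n.+1)) /= cesaro_fixed.
have ll' : l + l' = b.
  have ble : b <=v l + l'.
    apply: (vge_lim (u := fun n => s n + s' n) (cvgD sl sl')) => n.
    have := vleD (cs n) (cs' n); rewrite cx' => h.
    by apply: vle_lin h _; lin_module R E; ring.
  apply/esym/(phi_inj phi_pos phi_strict ble); apply/eqP.
  rewrite eq_le (phi_mono phi_pos ble) /=.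
  by move: phil phil'; rewrite [phi (b - x)]linearB [phi (l + l')]linearD /=; lra.
exists l => // eps eps0; have e2 : 0 < eps / 2 by rewrite divr_gt0.
move/cvgrPdist_le: sl => /(_ _ e2)[n1 _ h1].
move/cvgrPdist_le: sl' => /(_ _ e2)[n2 _ h2].
exists (maxn n1 n2); set n := maxn n1 n2.
have {}h1 := h1 n (leq_maxl _ _); have {}h2 := h2 n (leq_maxr _ _).
rewrite [eps]splitr; apply: le_trans (lerD h1 h2).
rewrite -[`|l - _|]normrN -[`|l' - _|]normrN !opprB.
apply: le_trans (ler_normD _ _); apply: norm_mono.
have g1 := vle_sub0 (ls n); have g2 := vle_sub0 (ls' n).
apply: modulus_lub.
  apply: vle_lin (vleD (cs n) g2) _; lin_module R E; ring.
have := cs' n; rewrite cx' -ll' => h.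
by apply: vle_lin (vleD h g1) _; lin_module R E; ring.
Qed.

Hypothesis zero_two_S : forall x (eps : R), 0 < eps ->
  exists k0, forall k, (k0 <= k)%N -> `|iter k S (x - S x)| <= eps.

(** Each difference [x - S^i x] telescopes into the image of a partial sum under
    [I - S]. *)
Lemma sub_cesaro_range n x : exists y, x - cesaro S n.+1 x = y - S y.
Proof.
exists (n.+1%:R^-1 *: \sum_(i < n.+1) psum S i x).
have -> : x - cesaro S n.+1 x = n.+1%:R^-1 *: \sum_(i < n.+1) (x - iter i S x).
  rewrite sumrB sumr_const card_ord scalerBr -(scaler_nat _ x) scalerA mulVf ?pnatr_eq0//.
  by rewrite scale1r.
rewrite (opZ S) -scalerBr (linear_sum S) -sumrB; congr (_ *: _).
apply: eq_bigr => i _; rewrite -psum_id_sub (opB (psum S i)) /=; congr (_ - _).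
by rewrite /psum linear_sum; apply: eq_bigr => j _ /=; rewrite -iterS iterSr.
Qed.

(** [S^k x - l] splits into [S^k] of an element in the range of [I - S] and [S^k]
    of the distance of a Cesaro mean to its limit [l]. *)
Lemma powers_cauchy x (eps : R) : 0 < eps -> exists k0, forall k j,
  (k0 <= k)%N -> (k0 <= j)%N -> `|iter k S x - iter j S x| <= eps.
Proof.
pose Y x := forall eps : R, 0 < eps -> exists k0, forall k j,
  (k0 <= k)%N -> (k0 <= j)%N -> `|iter k S x - iter j S x| <= eps.
suff : forall x, Y x by move=> h; exact: h.
have C1 : 0 < C + 1 by rewrite ltr_wpDl.
have Cle (a : R) z : 0 < a -> `|z| <= a / (C + 1) -> forall k, `|iter k S z| <= a.
  move=> a0 zle k; apply: le_trans (SC k z) _.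
  apply: le_trans (ler_wpM2l C0 zle) _; rewrite mulrA ler_pdivrMr// mulrC.
  by rewrite ler_pM2l// lerDl.
apply: (full_ideal_ind e0 efull) => {eps x} [n x x0 xe|x y Yx Yy|x h] eps eps0.
- have Sne : S (n%:R *: e) = n%:R *: e by rewrite (opZ S) Se.
  have [l Sl hl] := mean_ergodic x0 xe Sne.
  have e4 : 0 < eps / 4 by rewrite divr_gt0.
  have [i hi] := hl _ (divr_gt0 e4 C1).
  have [y yE] := sub_cesaro_range i x.
  have [k0 hk0] := zero_two_S y e4.
  have near k : (k0 <= k)%N -> `|iter k S x - l| <= eps / 2.
    move=> kk; have lk : iter k S l = l by elim: (k) => //= j ->.
    have -> : iter k S x - l = iter k S (y - S y) + iter k S (cesaro S i.+1 x - l).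
      rewrite -yE !(opB (iter k S)) /= lk; lin_module R E; ring.
    apply: le_trans (ler_normD _ _) _.
    have := hk0 k kk; have := Cle _ _ e4 hi k.
    by set r1 := `|_|; set r2 := `|_| => *; lra.
  exists k0 => k j /near hk /near hj.
  have -> : iter k S x - iter j S x = (iter k S x - l) - (iter j S x - l).
    by lin_module R E; ring.
  by apply: le_trans (ler_normB _ _) _; rewrite [eps]splitr; exact: lerD.
- have e2 : 0 < eps / 2 by rewrite divr_gt0.
  have [[k1 h1] [k2 h2]] := (Yx _ e2, Yy _ e2); exists (maxn k1 k2) => k j.
  rewrite !geq_max => /andP[k1k k2k] /andP[k1j k2j].
  have -> : iter k S (x - y) - iter j S (x - y) =
      (iter k S x - iter j S x) - (iter k S y - iter j S y).
    by rewrite (opB (iter k S)) (opB (iter j S)) /=; lin_module R E; ring.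
  by apply: le_trans (ler_normB _ _) _; rewrite [eps]splitr; apply: lerD; auto.
have e2 : 0 < eps / 2 by rewrite divr_gt0.
have e4 : 0 < eps / 4 by rewrite divr_gt0.
have [z [Yz zx]] := h _ (divr_gt0 e4 C1).
have [k0 hk0] := Yz _ e2; exists k0 => k j kk jj.
have -> : iter k S x - iter j S x = (iter k S z - iter j S z)
    - (iter k S (z - x) - iter j S (z - x)).
  by rewrite (opB (iter k S)) (opB (iter j S)) /=; lin_module R E; ring.
apply: le_trans (ler_normB _ _) _; rewrite [eps]splitr; apply: lerD; first exact: hk0.
apply: le_trans (ler_normB _ _) _.
have := Cle _ _ e4 zx k; have := Cle _ _ e4 zx j.
by set r1 := `|_|; set r2 := `|_| => *; lra.
Qed.

Lemma powers_converge : exists P : {linear E -> E}, continuous P /\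
  forall x, (fun k => iter k S x) @ \oo --> P x.
Proof.
have /choice[P hP] x : exists l : E, (fun k => iter k S x) @ \oo --> l.
  by apply: cauchy_ex_cvg => eps; exact: powers_cauchy.
have Plin : linear P.
  move=> a x y; apply: (cvg_unique _ (hP (a *: x + y))) => //.
  rewrite (_ : (fun k => _) = fun k => a *: iter k S x + iter k S y); last first.
    by apply/funext => k; rewrite linearP.
  by apply: cvgD => //; exact: cvgZl_tmp.
have PC x : `|P x| <= C * `|x|.
  apply: (cvgr_to_le (cvg_norm (hP x))); exists 0%N => // k _ /=; exact: SC.
exists (mklin Plin); split; last exact: hP.
exact: (@bounded_continuous _ _ _ (mklin Plin) C PC).
Qed.

End MeanErgodic.

(** * The convergence theorem *)

Section Limits.
Variables (R : realType) (E : banachLatticeType R) (T : {linear E -> E}).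
Implicit Types (x y z u v : E).

Lemma iter_iterE d k x : iter k (iter d T) x = iter (d * k) T x.
Proof. by elim: k => [|k IH]; rewrite ?muln0// mulnS iterD -IH. Qed.

(** Under strong positivity the fixed space of [T^d] is totally ordered: the
    images of the positive and negative parts of a fixed vector are disjoint,
    and only 0 is disjoint from a quasi-interior point. *)
Lemma fixed_iter_sign (phi : {scalar E}) d u : positive_op T ->
  strongly_positive T ->
  (forall x, 0 <=v x -> 0 <= phi x) -> (forall x, phi (T x) = phi x) ->
  (forall x, phi (modulus x) = 0 -> x = 0) -> (0 < d)%N ->
  iter d T u = u -> phi u = 0 -> u = 0.
Proof.
move=> Tpos Tstrong pp pT ps d0 Tu pu.
have phid x : phi (iter d T x) = phi x by elim: (d) => //= n IH; rewrite pT.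
have fixpos v : iter d T v = v -> iter d T (vpos v) = vpos v.
  move=> Tv; have le : vpos v <=v iter d T (vpos v).
    by rewrite -{1}Tv; exact: (posop_vpos (iter_pos d Tpos) v).
  by apply/esym/(phi_inj pp ps le); rewrite phid.
have Tup := fixpos _ Tu.
have Tun : iter d T (vpos (- u)) = vpos (- u).
  by apply: fixpos; rewrite (opN (iter d T)) /= Tu.
have disj : vdisj (T (vpos u)) (T (vpos (- u))).
  move=> z z1 z2.
  pose v := vmeet (T (vpos u)) (T (vpos (- u))).
  have v0 : 0 <=v v by apply: vmeet_glb; exact/Tpos/vpos_ge0.
  have itS x : iter d.-1 T (T x) = iter d T x by rewrite -iterSr prednK.
  have vz : iter d.-1 T v <=v 0.
    apply: (@vdisj_pos_neg _ _ u).
      by rewrite -Tup -itS; exact: (posop_mono (iter_pos _ Tpos) (vmeet_lel _ _)).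
    by rewrite -Tun -itS; exact: (posop_mono (iter_pos _ Tpos) (vmeet_ler _ _)).
  have phiv : phi v <= 0.
    have -> : phi v = phi (iter d.-1 T v) by elim: d.-1 => //= n IH; rewrite pT.
    by have := phi_mono pp vz; rewrite linear0.
  by rewrite -(phi_eq0 pp ps v0 phiv); exact: vmeet_glb.
have phis x : 0 <=v x -> T x = 0 -> x = 0.
  by move=> x0 Tx; apply: (phi_eq0 pp ps x0); rewrite -pT Tx linear0.
have [up0|upn0] := eqVneq (vpos u) 0.
  have un : 0 <=v - u by rewrite -[- u]vposBN opprK up0 subr0; exact: vpos_ge0.
  have := phi_eq0 pp ps un; rewrite linearN pu oppr0 lexx => /(_ isT) /eqP.
  by rewrite oppr_eq0 => /eqP.
have upgt : 0 <v vpos u by rewrite vpos_ge0 upn0.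
have [Tup0 _] := Tstrong _ upgt.
have := full_ideal_disj Tup0 (quasi_interior_full_ideal (Tstrong _ upgt))
  (Tpos _ (vpos_ge0 (- u))) disj.
move=> /(phis _ (vpos_ge0 _)) un0.
have u0 : 0 <=v u by rewrite -[u]vposBN un0 subr0; exact: vpos_ge0.
by apply: (phi_eq0 pp ps u0); rewrite pu.
Qed.

End Limits.

Theorem theorem4p3 (R : realType) (E : banachLatticeType R)
    (T : {linear E -> E})
    (hE : order_continuous_norm E)
    (T_pos : positive_op T)
    (T_bounded : power_bounded T)
    (T_irreducible : irreducible_op T)
    (T_harris : harris T)
    (T_fix : Fix T <> [set 0]) :
  (exists n : nat, (0 < n)%N /\
     strongly_converges (fun k : nat => iter (n * k) T)) /\
  (strongly_positive T ->
   exists (x' : {scalar E}) (e : E),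
     continuous (x' : E -> R) /\
     [/\ strictly_positive x',
         Fix (adjoint T) x',
         quasi_interior e,
         Fix T e
       & forall x : E, iter k T x @[k --> \oo] --> x' x *: e]).
Proof.
have [C C0 TC] := power_bounded_bound T_bounded.
have [phi [e [[pp pT pb ps] [e0 en0 Te]]]] :=
  fixed_point_setup T_pos TC T_irreducible T_fix.
have efull := fixed_full_ideal C0 T_pos TC T_irreducible e0 en0 Te.
have [m [d [L [d0 Lpos Lm Ldm Le]]]] :=
  overlapping_powers hE C0 T_pos TC T_irreducible pp pT ps e0 en0 Te T_harris.
have z2 := zero_two hE C0 T_pos TC T_irreducible pp pT pb ps e0 Te d0 Lpos Lm Ldm Le.
have Sbound k x : `|iter k (iter d T) x| <= C * `|x| by rewrite iter_iterE.
have Sphi x : phi (iter d T x) = phi x by exact: phi_iter.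
have Se : iter d T e = e by elim: (d) => //= n ->.
have Szero x (eps : R) : 0 < eps -> exists k0, forall k, (k0 <= k)%N ->
    `|iter k (iter d T) (x - iter d T x)| <= eps.
  move=> /(z2 x)[k0 hk0]; exists k0 => k kk; rewrite iter_iterE; apply: hk0.
  by apply: leq_trans kk _; exact: leq_pmull.
have [P [Pcont Pcvg]] :=
  powers_converge hE C0 (iter_pos d T_pos) Sbound pp Sphi pb ps e0 Se efull Szero.
split.
  exists d; split=> //; exists P; split=> // x.
  by rewrite (_ : (fun k => _) = fun k => iter k (iter d T) x)//;
    apply/funext => k; rewrite iter_iterE.
move=> Tstrong.
have pe0 : 0 < phi e by exact: phi_gt0.
have xlin : linear_for *%R (fun x => phi x / phi e).
  by move=> a x y; rewrite linearP mulrDl mulrA.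
pose x' : {scalar E} := HB.pack (fun x => phi x / phi e)
  (GRing.isLinear.Build R E R *%R (fun x => phi x / phi e) xlin).
exists x', e; split.
  apply: (@bounded_continuous R E R x' (C / phi e)) => x.
  rewrite /x' /= normrM [`|_^-1|]ger0_norm ?invr_ge0 ?(ltW pe0)// mulrAC.
  by apply: ler_wpM2r; [rewrite invr_ge0 ltW|exact: pb].
split.
- split=> [x x0|x xn0]; rewrite /x' /=; first by rewrite divr_ge0 ?pp// ltW.
  by rewrite divr_gt0// phi_gt0 ?modulus_ge0// -normr_eq0 norm_modulus normr_eq0.
- apply/funext => x; rewrite /adjoint /=.
  by rewrite -[LHS]/(phi x / phi e - phi (T x) / phi e) pT subrr.
- exact: full_ideal_quasi_interior.
- by rewrite /Fix /= Te subrr.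
move=> x; set c := x' x.
have Px : P x = c *: e.
  apply/eqP; rewrite -subr_eq0; apply/eqP.
  apply: (fixed_iter_sign T_pos Tstrong pp pT ps d0).
    rewrite (opB (iter d T)) (opZ (iter d T)) /= Se; congr (_ - _).
    have : (fun k => iter k.+1 (iter d T) x) @ \oo --> P x.
      by have := Pcvg x; rewrite -cvg_shiftS.
    by apply: cvg_unique => //; exact: (bounded_cvg (TC d) (Pcvg x)).
  have phiP : phi (P x) = phi x.
    apply: (cvg_unique _ (phi_cvg pb (Pcvg x))) => //.
    rewrite (_ : (fun k => _) = fun=> phi x); first exact: cvg_cst.
    by apply/funext => k; rewrite iter_iterE phi_iter.
  rewrite linearB linearZ /= phiP /c /x' /= divfK ?subrr//.
  by rewrite gt_eqF.
apply/cvgrPdist_le => eps eps0.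
have C1 : 0 < C + 1 by rewrite ltr_wpDl.
have := Pcvg x; rewrite Px => /cvgrPdist_le/(_ _ (divr_gt0 eps0 C1))[N _ hN].
(* Write [k] as [q d + r] with [r < d]: the first [q d] steps approach the fixed
   vector, and the last [r] steps only cost the factor [C]. *)
exists (d * N)%N => // k /= Nk.
have Tce j : iter j T (c *: e) = c *: e.
  by elim: j => //= j ->; rewrite opZ Te.
have -> : iter k T x = iter (k %% d) T (iter (k %/ d) (iter d T) x).
  by rewrite iter_iterE -iterD mulnC addnC -divn_eq.
rewrite -{1}(Tce (k %% d)%N) -(opB (iter (k %% d) T)); apply: le_trans (TC _ _) _.
have kN : (N <= k %/ d)%N by rewrite leq_divRL// mulnC.
apply: le_trans (ler_wpM2l C0 (hN _ kN)) _.
by rewrite mulrA ler_pdivrMr// mulrC ler_pM2l// lerDl.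
Qed.
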